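(* (i) For $N=3$ ($r_1>r_2>r_3>0$), set $\Xi_3=r_2(r_1^3-r_2^3+r_3^3)+r_1r_3^2(r_2-r_3)$ and $\Delta_3=\Xi_3^2-4r_1r_2r_3^2(r_2-r_3)(r_1^3-r_2^3)$ (which is positive). For all sufficiently small $\delta>0$ the equation $\det\mathbf{A}_3(\omega,\delta)=0$ has two roots with positive real part, depending continuously on $\delta$, with $$\omega_{3,1}(\delta)=v_{\mathrm r}\sqrt{\frac{3\Xi_3-3\sqrt{\Delta_3}}{2(r_2-r_3)(r_1^3-r_2^3)r_3^2}}\,\delta^{1/2}-\mathrm{i}\frac{3(-\Xi_3+\sqrt{\Delta_3})+6r_2(r_1^3-r_2^3)}{4\tau(r_1^3-r_2^3)\sqrt{\Delta_3}}\,r_1^2v_{\mathrm r}\,\delta+O(\delta^{3/2}),$$ $$\omega_{3,2}(\delta)=v_{\mathrm r}\sqrt{\frac{3\Xi_3+3\sqrt{\Delta_3}}{2(r_2-r_3)(r_1^3-r_2^3)r_3^2}}\,\delta^{1/2}-\mathrm{i}\frac{3(\Xi_3+\sqrt{\Delta_3})-6r_2(r_1^3-r_2^3)}{4\tau(r_1^3-r_2^3)\sqrt{\Delta_3}}\,r_1^2v_{\mathrm r}\,\delta+O(\delta^{3/2}).$$ (ii) For $N=4$ ($r_1>r_2>r_3>r_4>0$), set $\Xi_4=r_2r_3(r_1^3-r_2^3+r_3^3-r_4^3)+r_1(r_2-r_3)(r_3^3-r_4^3)$, $P=(r_1^3-r_2^3)(r_3^3-r_4^3)(r_2-r_3)$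 and $\Delta_4=\Xi_4^2-4r_1r_2r_3P$ (which is positive). For all sufficiently small $\delta>0$ the equation $\det\mathbf{A}_4(\omega,\delta)=0$ has two roots with positive real part, depending continuously on $\delta$, with $$\omega_{4,1}(\delta)=v_{\mathrm r}\sqrt{\frac{3\Xi_4-3\sqrt{\Delta_4}}{2P}}\,\delta^{1/2}-\mathrm{i}\frac{3(-\Xi_4+\sqrt{\Delta_4})+6r_2r_3(r_1^3-r_2^3)}{4\tau(r_1^3-r_2^3)\sqrt{\Delta_4}}\,v_{\mathrm r}r_1^2\,\delta+O(\delta^{3/2}),$$ $$\omega_{4,2}(\delta)=v_{\mathrm r}\sqrt{\frac{3\Xi_4+3\sqrt{\Delta_4}}{2P}}\,\delta^{1/2}-\mathrm{i}\frac{3(\Xi_4+\sqrt{\Delta_4})-6r_2r_3(r_1^3-r_2^3)}{4\tau(r_1^3-r_2^3)\sqrt{\Delta_4}}\,v_{\mathrm r}r_1^2\,\delta+O(\delta^{3/2}).$$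
   Context: Concentric balls: radii $r_1>r_2>\dots>r_N>0$, $D_0=\{|x|>r_1\}$, $D_j=\{r_{j+1}<|x|\le r_j\}$ ($1\le j\le N-1$), $D_N=\{|x|\le r_N\}$. Odd layers are resonators with density/bulk modulus $\rho_{\mathrm r},\kappa_{\mathrm r}$; even layers (including $D_0$) have $\rho,\kappa$. $v_{\mathrm r}=\sqrt{\kappa_{\mathrm r}/\rho_{\mathrm r}}$, $v=\sqrt{\kappa/\rho}$ are fixed positive constants, $k_{\mathrm r}=\omega/v_{\mathrm r}$, $k=\omega/v$, $\delta=\rho_{\mathrm r}/\rho$, $\tau=v/v_{\mathrm r}$. Let $j(t)=j_0(t)=\sin t/t$ and $h(t)=h^{(1)}_0(t)=-\mathrm{i}e^{\mathrm{i}t}/t$, with $'$ denoting $d/dt$. The monopolar transmission matrix $\mathbf{A}_N(\omega,\delta)$ is the $2N\times2N$ block tridiagonal matrix with $2\times2$ diagonal blocks $M_i$ ($1\le i\le N$), superdiagonal blocks $R_i$ ($1\le i\le N-1$) and subdiagonal blocks $L_i$ ($2\le i\le N$), where for $i$ odd: $M_i=\begin{pmatrix}-h(kr_i)&j(k_{\mathrm r}r_i)\\-\delta h'(kr_i)&\tau j'(k_{\mathrm r}r_i)\end{pmatrix}$, $R_i=\begin{pmatrix}h(k_{\mathrm r}r_i)&0\\ \tau h'(k_{\mathrm r}r_i)&0\end{pmatrix}$, $L_i=\begin{pmatrix}0&-j(kr_i)\\0&-\delta j'(kr_i)\end{pmatrix}$; for $i$ even: $M_i=\begin{pmatrix}-h(k_{\mathrm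 r}r_i)&j(kr_i)\\-\tau h'(k_{\mathrm r}r_i)&\delta j'(kr_i)\end{pmatrix}$, $R_i=\begin{pmatrix}h(kr_i)&0\\ \delta h'(kr_i)&0\end{pmatrix}$, $L_i=\begin{pmatrix}0&-j(k_{\mathrm r}r_i)\\0&-\tau j'(k_{\mathrm r}r_i)\end{pmatrix}$. *)

(* Defs.v *)
From HB Require Import structures.
From mathcomp Require Import all_boot all_order all_algebra.
From mathcomp Require Import all_classical all_reals all_analysis.
From mathcomp Require Import complex.
Set Implicit Arguments. Unset Strict Implicit. Unset Printing Implicit Defensive.
Import Order.TTheory GRing.Theory Num.Theory.
Import numFieldNormedType.Exports.
Local Open Scope ring_scope.
Local Open Scope complex_scope.

Section Special.
Variable R : realType.

Definition cexp (z : R[i]) : R[i] :=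
  (expR (complex.Re z))%:C * (cos (complex.Im z) +i* sin (complex.Im z)).

Definition csin (z : R[i]) : R[i] := (cexp ('i * z) - cexp (- ('i * z))) / (2%:R * 'i).
Definition ccos (z : R[i]) : R[i] := (cexp ('i * z) + cexp (- ('i * z))) / 2%:R.

Definition sbj (t : R[i]) : R[i] := csin t / t.
Definition sbj' (t : R[i]) : R[i] := ccos t / t - csin t / t ^+ 2.

Definition sbh (t : R[i]) : R[i] := - 'i * cexp ('i * t) / t.
Definition sbh' (t : R[i]) : R[i] := cexp ('i * t) / t + 'i * cexp ('i * t) / t ^+ 2.

Definition ent2 (a b : bool) (m00 m01 m10 m11 : R[i]) : R[i] :=
  if a then (if b then m11 else m10) else (if b then m01 else m00).

(* Block (i,j) (1-based block indices) of the monopolar transmission matrix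
   A_N(omega, delta), entry (a,b) of that block.
   vr = v_r, v = v, r i = r_i, w = omega, d = delta.
   For i odd:  M_i = [[-h(k r_i), j(kr r_i)], [-delta h'(k r_i), tau j'(kr r_i)]]
               R_i = [[h(kr r_i), 0], [tau h'(kr r_i), 0]]
               L_i = [[0, -j(k r_i)], [0, -delta j'(k r_i)]]
   For i even: M_i = [[-h(kr r_i), j(k r_i)], [-tau h'(kr r_i), delta j'(k r_i)]]
               R_i = [[h(k r_i), 0], [delta h'(k r_i), 0]]
               L_i = [[0, -j(kr r_i)], [0, -tau j'(kr r_i)]]
   All other blocks are zero. *)
Definition Ablock (vr v : R) (r : nat -> R) (w : R[i]) (d : R)
    (i j : nat) (a b : bool) : R[i] :=
  let k := w / v%:C in
  let kr := w / vr%:C in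
  let de := d%:C in
  let ta := (v / vr)%:C in
  let ri := (r i)%:C in
  if i == j then
    (if odd i then
       ent2 a b (- sbh (k * ri)) (sbj (kr * ri))
                (- de * sbh' (k * ri)) (ta * sbj' (kr * ri))
     else
       ent2 a b (- sbh (kr * ri)) (sbj (k * ri))
                (- ta * sbh' (kr * ri)) (de * sbj' (k * ri)))
  else if j == i.+1 then
    (if odd i then
       ent2 a b (sbh (kr * ri)) 0 (ta * sbh' (kr * ri)) 0
     else
       ent2 a b (sbh (k * ri)) 0 (de * sbh' (k * ri)) 0)
  else if i == j.+1 then
    (if odd i then
       ent2 a b 0 (- sbj (k * ri)) 0 (- de * sbj' (k * ri))
     else
       ent2 a b 0 (- sbj (kr * ri)) 0 (- ta * sbj' (kr * ri)))
  else 0.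

Definition Amat (N : nat) (vr v : R) (r : nat -> R) (w : R[i]) (d : R)
    : 'M[R[i]]_(N.*2) :=
  \matrix_(p < N.*2, q < N.*2)
    Ablock vr v r w d (p./2).+1 (q./2).+1 (odd p) (odd q).

Definition resonance_root (N : nat) (vr v : R) (r : nat -> R) (c1 c2 : R)
    (d0 : R) (w : R -> R[i]) : Prop :=
  [/\ forall d : R, 0 < d < d0 -> \det (Amat N vr v r (w d) d) = 0,
      forall d : R, 0 < d < d0 -> 0 < complex.Re (w d),
      forall d : R, 0 < d < d0 ->
        {for d, continuous (fun e : R => complex.Re (w e))} /\
        {for d, continuous (fun e : R => complex.Im (w e))} &
      exists K : R, forall d : R, 0 < d < d0 ->
        `| w d - ((c1 * Num.sqrt d)%:C - 'i * (c2 * d)%:C) |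
          <= (K * (d * Num.sqrt d))%:C ].

End Special.

Definition Xi3 {R : realType} (r : nat -> R) : R :=
  r 2%N * (r 1%N ^+ 3 - r 2%N ^+ 3 + r 3%N ^+ 3) + r 1%N * r 3%N ^+ 2 * (r 2%N - r 3%N).
Definition Delta3 {R : realType} (r : nat -> R) : R :=
  Xi3 r ^+ 2 - 4%:R * r 1%N * r 2%N * r 3%N ^+ 2 * (r 2%N - r 3%N) * (r 1%N ^+ 3 - r 2%N ^+ 3).

Definition Xi4 {R : realType} (r : nat -> R) : R :=
  r 2%N * r 3%N * (r 1%N ^+ 3 - r 2%N ^+ 3 + r 3%N ^+ 3 - r 4%N ^+ 3)
  + r 1%N * (r 2%N - r 3%N) * (r 3%N ^+ 3 - r 4%N ^+ 3).
Definition P4 {R : realType} (r : nat -> R) : R :=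
  (r 1%N ^+ 3 - r 2%N ^+ 3) * (r 3%N ^+ 3 - r 4%N ^+ 3) * (r 2%N - r 3%N).
Definition Delta4 {R : realType} (r : nat -> R) : R :=
  Xi4 r ^+ 2 - 4%:R * r 1%N * r 2%N * r 3%N * P4 r.

(* Main.v *)
Require Import Defs.
From HB Require Import structures.
From mathcomp Require Import all_boot all_order all_algebra.
From mathcomp Require Import all_classical all_reals all_analysis.
From mathcomp Require Import complex ring lra.
Import Order.TTheory GRing.Theory Num.Theory.
Import numFieldNormedType.Exports.
Local Open Scope ring_scope.
Local Open Scope complex_scope.

(** A radial solution of the Helmholtz equation in a layer is [u = g(|x|)/|x|] with
    [g'' = - k^2 g]; it is carried from one interface to the next by its value [U] and its
    flux [F], where [u' = F] in the background and [u' = delta F] in a resonator, so that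
    [(U, F)] is continuous across interfaces.  Starting from the regular solution in the
    innermost ball, a kernel vector of the transmission matrix exists as soon as the state
    at [r_1] is outgoing, [U + r_1 F = i k r_1 U].

    Put [omega = e z], [delta = e^2].  Through a resonator [U] is unchanged and the flux
    picks up a multiple of [z^2 U], up to [O(e^2)]; hence the outgoing condition is
    [(z - c) G(z) + e L(z) + O(e^2) = 0], where [(z - c) G(z)] is a quadratic polynomial in
    [z^2] whose roots give the leading terms.  A contraction around [c - e L(c)/G(c)] yields
    the roots.  [N = 3] is the case of a core of radius [0] in the shell computation
    for [N = 4]. *)

(** The determinant is never expanded: a nonzero kernel vector suffices for a root, and it reduces
    the block system to a composition of 2 by 2 transfers. No complex analysis is used. A
    contraction only needs Lipschitz control of the remainders in z, so size and Lipschitz bounds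
    travel together, uniformly on a disc around c that avoids 0. The delicate point is the resonator
    flux, whose formula is divided by delta = e^2: its terms of order zero in k must cancel exactly,
    and Taylor remainders of order four must be kept, so that an O(e^2) error survives the division.
    The first-order correction is purely imaginary because L(c) carries the factor -i of the
    radiation condition, while G(c) is real. It is well defined because G(c) is nonzero, that is,
    because the two roots of the leading quadratic are distinct. Continuity in delta comes from the
    same contraction inequality that gives existence. *)

Section ComplexNorm.
Context {R : realType}.
Implicit Types z w : R[i].

(* The library norm of [R[i]] takes its values in [R[i]]; [nr] is its real-valued version. *)
Definition nr z : R := complex.Re `|z|.

Lemma nrE z : `|z| = (nr z)%:C.
Proof. by rewrite /nr normc_def. Qed.

Lemma nr_ge0 z : 0 <= nr z.
Proof. by have := normr_ge0 z; rewrite nrE lecR. Qed.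

Lemma nrM z w : nr (z * w) = nr z * nr w.
Proof. by apply: (@complexI R); rewrite rmorphM /= -!nrE normrM. Qed.

Lemma nrD z w : nr (z + w) <= nr z + nr w.
Proof. by rewrite -lecR rmorphD /= -!nrE ler_normD. Qed.

Lemma nrN z : nr (- z) = nr z.
Proof. by rewrite /nr normrN. Qed.

Lemma nrB z w : nr (z - w) <= nr z + nr w.
Proof. by rewrite -(nrN w) nrD. Qed.

Lemma nrC z w : nr (z - w) = nr (w - z).
Proof. by rewrite -nrN opprB. Qed.

Lemma nr0 : nr (0 : R[i]) = 0.
Proof. by rewrite /nr normr0. Qed.

Lemma nr_eq0 z : (nr z == 0) = (z == 0).
Proof. by rewrite -[RHS]normr_eq0 nrE fmorph_eq0. Qed.

Lemma nr_gt0 z : (0 < nr z) = (z != 0).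
Proof. by rewrite lt_def nr_ge0 nr_eq0 andbT. Qed.

Lemma nrV z : nr z^-1 = (nr z)^-1.
Proof. by apply: (@complexI R); rewrite fmorphV /= -!nrE normfV. Qed.

Lemma nrR (x : R) : nr x%:C = `|x|.
Proof. by rewrite /nr normc_def /= expr0n addr0 sqrtr_sqr. Qed.

Lemma nri : nr ('i : R[i]) = 1.
Proof. by rewrite /nr normc_def /= expr0n add0r expr1n sqrtr1. Qed.

Lemma ler_Re_nr z : `|complex.Re z| <= nr z.
Proof. by rewrite -lecR -nrE normc_ge_Re. Qed.

Lemma ler_Im_nr z : `|complex.Im z| <= nr z.
Proof.
have -> : complex.Im z = complex.Re (- 'i * z) by case: z => a b; rewrite /=; ring.
by apply: le_trans (ler_Re_nr _) _; rewrite nrM nrN nri mul1r.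
Qed.

Lemma ler_nr z : nr z <= `|complex.Re z| + `|complex.Im z|.
Proof.
rewrite {1}[z]complexE; apply: le_trans (nrD _ _) _.
by rewrite nrM nri mul1r !nrR.
Qed.

Lemma sqri : 'i * 'i = -1 :> R[i].
Proof. by rewrite -expr2 sqr_i. Qed.

Lemma cexpD z w : cexp (z + w) = cexp z * cexp w.
Proof.
case: z w => a b [c d]; rewrite /cexp /= expRD cosD sinD.
apply/eqP; rewrite eq_complex /=; apply/andP; split; apply/eqP; ring.
Qed.

Lemma cexp0 : cexp (0 : R[i]) = 1.
Proof. by rewrite /cexp /= expR0 cos0 sin0 mul1r. Qed.

Lemma cexp_neq0 z : cexp z != 0.
Proof.
apply: contra_not_neq (_ : ~ cexp (z - z) = 0); first by rewrite cexpD => ->; rewrite mul0r.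
by rewrite subrr cexp0; apply/eqP; exact: oner_neq0.
Qed.

Lemma cexpN z : cexp (- z) = (cexp z)^-1.
Proof.
by apply: (mulfI (cexp_neq0 z)); rewrite -cexpD subrr cexp0 mulfV ?cexp_neq0.
Qed.

Lemma nr_cexp z : nr (cexp z) = expR (complex.Re z).
Proof.
rewrite /cexp nrM nrR ger0_norm ?expR_ge0 //.
by rewrite /nr normc_def /= cos2Dsin2 sqrtr1 mulr1.
Qed.

End ComplexNorm.

(** * Derivatives along a real parameter, exponential remainders, continuity *)

Section SegmentDerivative.
Context {R : realType}.
Implicit Types (f g : R -> R[i]) (z w : R[i]).

(** One real parameter is enough: Lipschitz bounds in a complex variable come from differentiating
    along the segment between two points. *)
Definition is_cderiv (t : R) f (df : R[i]) :=
  is_derive t 1 (fun s => complex.Re (f s)) (complex.Re df) /\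
  is_derive t 1 (fun s => complex.Im (f s)) (complex.Im df).

Lemma Re_add z w : complex.Re (z + w) = complex.Re z + complex.Re w.
Proof. by case: z w => [? ?] []. Qed.
Lemma Im_add z w : complex.Im (z + w) = complex.Im z + complex.Im w.
Proof. by case: z w => [? ?] []. Qed.
Lemma Re_opp z : complex.Re (- z) = - complex.Re z.
Proof. by case: z. Qed.
Lemma Im_opp z : complex.Im (- z) = - complex.Im z.
Proof. by case: z. Qed.
Lemma Re_mul z w : complex.Re (z * w) =
  complex.Re z * complex.Re w - complex.Im z * complex.Im w.
Proof. by case: z w => [? ?] []. Qed.
Lemma Im_mul z w : complex.Im (z * w) =
  complex.Re z * complex.Im w + complex.Im z * complex.Re w.
Proof. by case: z w => [? ?] []. Qed.

Lemma is_derive_mul (t : R) (f g : R -> R) (df dg : R) :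
  is_derive t 1 f df -> is_derive t 1 g dg ->
  is_derive t 1 (fun s => f s * g s) (f t * dg + g t * df).
Proof. exact: is_deriveM. Qed.

Lemma is_derive_sub (t : R) (f g : R -> R) (df dg : R) :
  is_derive t 1 f df -> is_derive t 1 g dg ->
  is_derive t 1 (fun s => f s - g s) (df - dg).
Proof. exact: is_deriveB. Qed.

Lemma is_derive_add (t : R) (f g : R -> R) (df dg : R) :
  is_derive t 1 f df -> is_derive t 1 g dg ->
  is_derive t 1 (fun s => f s + g s) (df + dg).
Proof. exact: is_deriveD. Qed.

Lemma is_cderiv_cst t z : is_cderiv t (fun=> z) 0.
Proof. by split; exact: is_derive_cst. Qed.

Lemma is_cderiv_id t : is_cderiv t (fun s => s%:C) 1.
Proof. by split => /=; [exact: is_derive_id | exact: is_derive_cst]. Qed.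

Lemma is_cderivD t f g df dg : is_cderiv t f df -> is_cderiv t g dg ->
  is_cderiv t (fun s => f s + g s) (df + dg).
Proof.
move=> [f1 f2] [g1 g2]; split.
  rewrite Re_add; under eq_fun do rewrite Re_add; exact: is_deriveD.
rewrite Im_add; under eq_fun do rewrite Im_add; exact: is_deriveD.
Qed.

Lemma is_cderivM t f g df dg : is_cderiv t f df -> is_cderiv t g dg ->
  is_cderiv t (fun s => f s * g s) (df * g t + f t * dg).
Proof.
move=> [f1 f2] [g1 g2]; split.
  under eq_fun do rewrite Re_mul.
  refine (is_derive_eq (is_derive_sub _ _ _ _ _ (is_derive_mul _ _ _ _ _ f1 g1)
    (is_derive_mul _ _ _ _ _ f2 g2)) _).
  rewrite Re_add !Re_mul; ring.
under eq_fun do rewrite Im_mul.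
refine (is_derive_eq (is_derive_add _ _ _ _ _ (is_derive_mul _ _ _ _ _ f1 g2)
  (is_derive_mul _ _ _ _ _ f2 g1)) _).
rewrite Im_add !Im_mul; ring.
Qed.

Lemma is_cderivX t f df n : is_cderiv t f df ->
  is_cderiv t (fun s => f s ^+ n.+1) (n.+1%:R * df * f t ^+ n).
Proof.
move=> fd; elim: n => [|n IH].
  rewrite mul1r expr0 mulr1; by under eq_fun do rewrite expr1.
under eq_fun do rewrite exprS.
have -> : n.+2%:R * df * f t ^+ n.+1 = df * f t ^+ n.+1 + f t * (n.+1%:R * df * f t ^+ n).
  rewrite exprS -[n.+2%:R]natr1; ring.
exact: is_cderivM.
Qed.

Lemma is_cderiv_cexp t f df : is_cderiv t f df ->
  is_cderiv t (fun s => cexp (f s)) (df * cexp (f t)).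
Proof.
move=> [f1 f2].
have e1 : is_derive t 1 (expR \o (fun s => complex.Re (f s)))
    (expR (complex.Re (f t)) * complex.Re df) by exact: is_derive1_comp.
have c1 : is_derive t 1 (cos \o (fun s => complex.Im (f s)))
    (- sin (complex.Im (f t)) * complex.Im df) by exact: is_derive1_comp.
have s1 : is_derive t 1 (sin \o (fun s => complex.Im (f s)))
    (cos (complex.Im (f t)) * complex.Im df) by exact: is_derive1_comp.
split.
  under eq_fun do rewrite /cexp Re_mul /= mul0r subr0.
  refine (is_derive_eq (is_derive_mul _ _ _ _ _ e1 c1) _).
  rewrite /cexp ?Re_mul !Im_mul ?Re_mul /=; ring.
under eq_fun do rewrite /cexp Im_mul /= mul0r addr0.
refine (is_derive_eq (is_derive_mul _ _ _ _ _ e1 s1) _).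
rewrite /cexp ?Re_mul !Im_mul ?Re_mul /=; ring.
Qed.

(** The mean value equality fails for complex values, so it is applied to the real and imaginary
    parts separately; this costs the factor 2. *)
Lemma nr_segment_le f (df : R -> R[i]) (B : R) : (forall t, is_cderiv t f (df t)) ->
  (forall t : R, 0 <= t <= 1 -> nr (df t) <= B) -> nr (f 1 - f 0) <= 2 * B.
Proof.
move=> fd fB.
have part (g dg : R -> R) : (forall t : R, is_derive t 1 g (dg t)) ->
    (forall t : R, 0 <= t <= 1 -> `|dg t| <= B) -> `|g 1 - g 0| <= B.
  move=> gd gB.
  have [|c c01 ->] := @MVT R g dg 0 1 ltr01 (fun x _ => gd x).
    by apply: derivable_within_continuous => x _; case: (gd x).
  rewrite subr0 mulr1; apply: gB; move: c01; rewrite in_itv /= => /andP[/ltW -> /ltW ->] //.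
apply: le_trans (ler_nr _) _; rewrite mulrDl mul1r; apply: lerD.
  have -> : complex.Re (f 1 - f 0) = complex.Re (f 1) - complex.Re (f 0).
    by case: (f 1) (f 0) => [? ?] [].
  apply: (part (fun s => complex.Re (f s)) (fun s => complex.Re (df s))).
    by move=> t; have [] := fd t.
  by move=> t /fB; apply: le_trans; exact: ler_Re_nr.
have -> : complex.Im (f 1 - f 0) = complex.Im (f 1) - complex.Im (f 0).
  by case: (f 1) (f 0) => [? ?] [].
apply: (part (fun s => complex.Im (f s)) (fun s => complex.Im (df s))).
  by move=> t; have [] := fd t.
by move=> t /fB; apply: le_trans; exact: ler_Im_nr.
Qed.

(** Taylor remainder of the exponential after [n] terms. Its derivative is the remainder with one
    term fewer, which allows induction down to [erem 0], the exponential itself. *)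
Definition erem (n : nat) z : R[i] := cexp z - \sum_(k < n) z ^+ k / k`!%:R.

Lemma erem0 n : erem n.+1 (0 : R[i]) = 0.
Proof.
rewrite /erem cexp0 big_ord_recl /= expr0 fact0 divr1 big1 ?addr0 ?subrr //.
by move=> i _; rewrite /= /bump /= exprS !mul0r.
Qed.

Lemma is_cderiv_erem n t z w :
  is_cderiv t (fun s => erem n.+1 (z + s%:C * w)) (w * erem n (z + t%:C * w)).
Proof.
have line : is_cderiv t (fun s => z + s%:C * w) w.
  have := is_cderivD _ _ _ _ _ (is_cderiv_cst t z)
    (is_cderivM _ _ _ _ _ (is_cderiv_id t) (is_cderiv_cst t w)).
  by rewrite add0r mul1r mulr0 addr0.
elim: n => [|n IH].
  rewrite /erem; under eq_fun do rewrite big_ord_recl big_ord0 expr0 fact0 divr1 addr0.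
  rewrite big_ord0 subr0 -[w * _]addr0.
  exact: is_cderivD (is_cderiv_cexp _ _ _ line) (is_cderiv_cst _ _).
have step m x : erem m.+1 x = erem m x + (- (m`!%:R)^-1) * x ^+ m.
  by rewrite /erem big_ord_recr /=; ring.
under eq_fun do rewrite step.
have -> : w * erem n.+1 (z + t%:C * w) = w * erem n (z + t%:C * w) +
    (0 * (z + t%:C * w) ^+ n.+1 +
     (- (n.+1`!%:R)^-1) * (n.+1%:R * w * (z + t%:C * w) ^+ n)).
  rewrite step factS natrM invfM.
  have : (n.+1%:R : R[i]) != 0 by rewrite pnatr_eq0.
  have : (n`!%:R : R[i]) != 0 by rewrite pnatr_eq0 -lt0n fact_gt0.
  move: (n.+1%:R : R[i]) (n`!%:R : R[i]) => p q q0 p0.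
  by field; rewrite q0 p0.
apply: is_cderivD IH _; apply: is_cderivM (is_cderiv_cst _ _) _.
exact: is_cderivX.
Qed.

Lemma erem_lipschitz n (B : R) : 0 <= B -> exists2 K : R, 0 <= K &
  forall (b : R) z w, b <= B -> nr z <= b -> nr w <= b ->
    nr (erem n.+1 z - erem n.+1 w) <= K * b ^+ n * nr (z - w).
Proof.
move=> B0; elim: n => [|n [K K0 IH]].
  exists (2 * expR B) => [|b z w bB zb wb]; first by rewrite mulr_ge0 ?expR_ge0.
  have := nr_segment_le (fun t => erem 1 (w + t%:C * (z - w))) _
    (nr (z - w) * expR B) (fun t => is_cderiv_erem 0 t w (z - w)).
  rewrite rmorph1 rmorph0 mul1r mul0r addr0 [w + _]addrC subrK expr0 mulr1 => H.
  apply: le_trans (H _) _ => [t t01|]; last by rewrite mulrA [_ * expR B]mulrC mulrA [expR B * 2]mulrC.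
  rewrite nrM /erem big_ord0 subr0 nr_cexp ler_wpM2l ?nr_ge0 // ler_expR.
  apply: le_trans (ler_norm _) _; apply: le_trans (ler_Re_nr _) _.
  have -> : w + t%:C * (z - w) = (1 - t)%:C * w + t%:C * z by rewrite rmorphB /=; ring.
  move: t01 => /andP[t0 t1]; apply: le_trans (nrD _ _) _; rewrite !nrM !nrR !ger0_norm ?subr_ge0 //.
  by have := nr_ge0 w; have := nr_ge0 z; nra.
exists (2 * K) => [|b z w bB zb wb]; first by rewrite mulr_ge0.
have b0 : 0 <= b by exact: le_trans (nr_ge0 _) zb.
have := nr_segment_le (fun t => erem n.+2 (w + t%:C * (z - w))) _
  (nr (z - w) * (K * b ^+ n * b)) (fun t => is_cderiv_erem n.+1 t w (z - w)).
rewrite rmorph1 rmorph0 mul1r mul0r addr0 [w + _]addrC subrK => H.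
apply: le_trans (H _) _ => [t t01|]; last by rewrite exprSr le_eqVlt; apply/orP; left; apply/eqP; ring.
rewrite nrM ler_wpM2l ?nr_ge0 //.
set u := w + _.
have ub : nr u <= b.
  rewrite /u; have -> : w + t%:C * (z - w) = (1 - t)%:C * w + t%:C * z by rewrite rmorphB /=; ring.
  move: t01 => /andP[t0 t1]; apply: le_trans (nrD _ _) _; rewrite !nrM !nrR !ger0_norm ?subr_ge0 //.
  by nra.
have := IH b u 0 bB ub; rewrite nr0 erem0 !subr0 => /(_ b0) h.
by apply: le_trans h _; rewrite ler_wpM2l // mulr_ge0 // exprn_ge0.
Qed.

(** Continuity in the componentwise form that [resonance_root] asks for. *)
Definition ccont (t : R) f :=
  {for t, continuous (fun s => complex.Re (f s))} /\
  {for t, continuous (fun s => complex.Im (f s))}.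

Lemma ccontP t f (g h : R -> R) : (forall s, f s = g s +i* h s) ->
  {for t, continuous g} -> {for t, continuous h} -> ccont t f.
Proof.
move=> fE gt ht; have -> : f = (fun s => g s +i* h s) by exact/funext.
by [].
Qed.

Lemma ccont_cst t z : ccont t (fun=> z).
Proof. by split; exact: cvg_cst. Qed.

Lemma ccont_id t : ccont t (fun s => s%:C).
Proof. by split => /=; [exact: cvg_id | exact: cvg_cst]. Qed.

Lemma ccontD t f g : ccont t f -> ccont t g -> ccont t (fun s => f s + g s).
Proof.
move=> [f1 f2] [g1 g2].
apply: (@ccontP t _ (fun s => complex.Re (f s) + complex.Re (g s))
  (fun s => complex.Im (f s) + complex.Im (g s))) => [s||].
- by case: (f s) (g s) => [? ?] [].
- exact: continuousD.
- exact: continuousD.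
Qed.

Lemma ccontM t f g : ccont t f -> ccont t g -> ccont t (fun s => f s * g s).
Proof.
move=> [f1 f2] [g1 g2].
apply: (@ccontP t _
  (fun s => complex.Re (f s) * complex.Re (g s) - complex.Im (f s) * complex.Im (g s))
  (fun s => complex.Re (f s) * complex.Im (g s) + complex.Im (f s) * complex.Re (g s)))
  => [s||].
- by case: (f s) (g s) => [? ?] [].
- by apply: continuousB; apply: continuousM.
- by apply: continuousD; apply: continuousM.
Qed.

Lemma ccont_cexp t f : ccont t f -> ccont t (fun s => cexp (f s)).
Proof.
move=> [f1 f2].
have e1 : {for t, continuous (fun s => expR (complex.Re (f s)))}.
  by apply: (@continuous_comp _ _ _ (fun s => complex.Re (f s)) expR) => //; exact: continuous_expR.
have c1 : {for t, continuous (fun s => cos (complex.Im (f s)))}.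
  by apply: (@continuous_comp _ _ _ (fun s => complex.Im (f s)) cos) => //; exact: continuous_cos.
have s1 : {for t, continuous (fun s => sin (complex.Im (f s)))}.
  by apply: (@continuous_comp _ _ _ (fun s => complex.Im (f s)) sin) => //; exact: continuous_sin.
apply: (@ccontP t _ (fun s => expR (complex.Re (f s)) * cos (complex.Im (f s)))
  (fun s => expR (complex.Re (f s)) * sin (complex.Im (f s)))) => [s||].
- rewrite /cexp; apply/eqP; rewrite eq_complex /=.
  by apply/andP; split; apply/eqP; ring.
- exact: continuousM.
- exact: continuousM.
Qed.

Lemma ccont_sum t n (F : 'I_n -> R -> R[i]) :
  (forall i, ccont t (F i)) -> ccont t (fun s => \sum_(i < n) F i s).
Proof.
move=> Fc; elim: n F Fc => [|n IH] F Fc.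
  by under eq_fun do rewrite big_ord0; exact: ccont_cst.
by under eq_fun do rewrite big_ord_recr; apply: ccontD => //; exact: IH.
Qed.

Lemma ccontX t f n : ccont t f -> ccont t (fun s => f s ^+ n).
Proof.
move=> fc; elim: n => [|n IH].
  by under eq_fun do rewrite expr0; exact: ccont_cst.
by under eq_fun do rewrite exprS; exact: ccontM.
Qed.

Lemma ccont_erem t f n : ccont t f -> ccont t (fun s => erem n (f s)).
Proof.
move=> fc; rewrite /erem.
under eq_fun do rewrite -mulN1r.
apply: ccontD; first exact: ccont_cexp.
apply: ccontM; first exact: ccont_cst.
apply: (@ccont_sum t n (fun k s => f s ^+ k / k`!%:R)) => k.
by apply: ccontM; [exact: ccontX | exact: ccont_cst].
Qed.

Lemma ccontVr (t : R) : 0 < t -> ccont t (fun s => (s%:C)^-1).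
Proof.
move=> t0; apply: (@ccontP t _ (fun s : R => s^-1) (fun=> 0)) => [s||].
- by rewrite -fmorphV.
- by apply: continuousV; [rewrite gt_eqF | exact: cvg_id].
- exact: cvg_cst.
Qed.

End SegmentDerivative.

(** * Newton iteration with a frozen slope *)

Section Newton.
Context {R : realType}.
Implicit Types z w : R[i].

Lemma cvg_geometric_increments (u : nat -> R) (B : R) :
  (forall n, `|u n.+1 - u n| <= B * 2^-1 ^+ n) -> cvgn u.
Proof.
move=> uB.
have -> : u = (fun n => u 0%N + series (telescope u) n).
  by apply/funext => n; exact: eq_sum_telescope.
apply: is_cvgD; first exact: is_cvg_cst.
apply: normed_cvg; apply: (@series_le_cvg _ _ (geometric B 2^-1)) => //.
- by move=> n; exact: normr_ge0.
- by move=> n; apply: le_trans (uB n); exact: normr_ge0.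
- by apply: is_cvg_geometric_series; rewrite ger0_norm ?invr_ge0 // invf_lt1 // ltr1n.
Qed.

(** The map [z - H z / a] halves distances on the disc of radius [2 * eta], and its first step from
    [z0] has length at most [eta]; hence the disc is mapped into itself and the iterates converge
    geometrically. *)
Lemma contraction_root (H : R[i] -> R[i]) (a z0 : R[i]) (eta : R) :
  a != 0 -> 0 <= eta ->
  (forall z w, nr (z - z0) <= 2 * eta -> nr (w - z0) <= 2 * eta ->
    nr (H z - H w - a * (z - w)) <= nr a / 2 * nr (z - w)) ->
  nr (H z0) <= nr a * eta ->
  exists2 z, nr (z - z0) <= 2 * eta & H z = 0.
Proof.
move=> a0 eta0 Hlip Hz0; have na0 : 0 < nr a by rewrite nr_gt0.
pose T z := z - H z / a.
have Tlip z w : nr (z - z0) <= 2 * eta -> nr (w - z0) <= 2 * eta ->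
    nr (T z - T w) <= 2^-1 * nr (z - w).
  move=> hz hw; have -> : T z - T w = - ((H z - H w - a * (z - w)) / a) by rewrite /T; field.
  rewrite nrN nrM nrV ler_pdivrMr //; apply: le_trans (Hlip _ _ hz hw) _.
  by rewrite le_eqVlt; apply/orP; left; apply/eqP; ring.
have z0z0 : nr (z0 - z0) <= 2 * eta by rewrite subrr nr0; lra.
have T0 : nr (T z0 - z0) <= eta.
  have -> : T z0 - z0 = - (H z0 / a) by rewrite /T; ring.
  by rewrite nrN nrM nrV ler_pdivrMr // mulrC.
have Tball z : nr (z - z0) <= 2 * eta -> nr (T z - z0) <= 2 * eta.
  move=> hz; have -> : T z - z0 = (T z - T z0) + (T z0 - z0) by ring.
  by apply: le_trans (nrD _ _) _; have := Tlip _ _ hz z0z0; lra.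
pose u n := iter n T z0.
have uball n : nr (u n - z0) <= 2 * eta by elim: n => //= n IH; exact: Tball.
have ustep n : nr (u n.+1 - u n) <= eta * 2^-1 ^+ n.
  elim: n => [|n IH]; first by rewrite expr0 mulr1.
  have -> : u n.+2 - u n.+1 = T (u n.+1) - T (u n) by [].
  apply: le_trans (Tlip _ _ (uball _) (uball _)) _.
  by rewrite exprS mulrCA ler_wpM2l // invr_ge0.
have /cvg_ex [x /= ux] : cvgn (fun n => complex.Re (u n)).
  apply: (cvg_geometric_increments _ eta) => n; apply: le_trans (ustep n).
  by rewrite -Re_opp -Re_add; exact: ler_Re_nr.
have /cvg_ex [y /= uy] : cvgn (fun n => complex.Im (u n)).
  apply: (cvg_geometric_increments _ eta) => n; apply: le_trans (ustep n).
  by rewrite -Im_opp -Im_add; exact: ler_Im_nr.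
have close (e : R) : 0 < e -> exists n, nr ((x +i* y) - u n) < e /\ nr ((x +i* y) - u n.+1) < e.
  move=> e0; have e2 : 0 < e / 2 by rewrite divr_gt0.
  move/cvgrPdist_lt : ux => /(_ _ e2) [N1 _ h1].
  move/cvgrPdist_lt : uy => /(_ _ e2) [N2 _ h2].
  have near n : (maxn N1 N2 <= n)%N -> nr ((x +i* y) - u n) < e.
    rewrite geq_max => /andP[n1 n2]; apply: le_lt_trans (ler_nr _) _.
    have := h1 _ n1; have := h2 _ n2; rewrite /= => b1 b2.
    by rewrite Re_add Im_add Re_opp Im_opp /=; lra.
  by exists (maxn N1 N2); split; apply: near => //; exact: leqnSn.
exists (x +i* y).
  apply/ler_addgt0Pr => e e0; have [n [un _]] := close e e0.
  have -> : (x +i* y) - z0 = ((x +i* y) - u n) + (u n - z0) by ring.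
  by apply: le_trans (nrD _ _) _; have := uball n; lra.
set z := x +i* y.
have zball : nr (z - z0) <= 2 * eta.
  apply/ler_addgt0Pr => e e0; have [n [un _]] := close e e0.
  have -> : z - z0 = (z - u n) + (u n - z0) by ring.
  by apply: le_trans (nrD _ _) _; have := uball n; rewrite /z; lra.
(* The limit is a fixed point: some iterate and its successor are both close to it, and [T] is
   1/2-Lipschitz. *)
have /eqP : nr (T z - z) = 0.
  apply/eqP; rewrite eq_le nr_ge0 andbT; apply/ler_addgt0Pr => e e0; rewrite add0r.
  have e2 : 0 < e / 2 by rewrite divr_gt0.
  have [n [un un1]] := close _ e2.
  have -> : T z - z = (T z - T (u n)) - (z - u n.+1) by rewrite /u /=; ring.
  apply: le_trans (nrB _ _) _; have := Tlip _ _ zball (uball n).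
  by have := nr_ge0 (z - u n); rewrite -/z in un un1; lra.
rewrite nr_eq0 /T => /eqP h.
have : H z / a = 0 by rewrite -[LHS]opprK -[RHS]oppr0 -h; congr (- _); ring.
by move/eqP; rewrite mulf_eq0 invr_eq0 (negbTE a0) orbF => /eqP.
Qed.

End Newton.

(** * Uniform orders in e on a disc around c, and perturbation of a simple root *)

Section UniformOrder.
Context {R : realType}.
Variable c : R.
Implicit Types (f g : R[i] -> R -> R[i]) (z w : R[i]).

(** The radius [c / 2] keeps [z^-1] bounded and the real part of [z] positive. *)
Definition halfball z := nr (z - c%:C) <= c / 2.

(* Uniform [O(e^n)] bounds together with Lipschitz bounds of the same order, which stand in
   for bounds on the derivative in [z]. *)
Definition has_order n f :=
  (exists2 K : R, 0 <= K & forall e, 0 < e <= 1 -> forall z w, halfball z -> halfball w ->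
     nr (f z e) <= K * e ^+ n /\ nr (f z e - f w e) <= K * e ^+ n * nr (z - w)) /\
  (forall z, halfball z -> forall e, 0 < e -> ccont e (f z)).

(** Agreement for positive e suffices also for continuity, since every point close to a positive e
    is positive; the divisions by e are meaningful only there. *)
Lemma has_order_ext n f g : (forall z e, halfball z -> 0 < e -> f z e = g z e) ->
  has_order n f -> has_order n g.
Proof.
move=> fg [[K K0 fK] fc]; split.
  exists K => // e e01 z w hz hw; have /andP[e0 _] := e01.
  by rewrite -!fg //; exact: fK.
move=> z hz e e0; have [f1 f2] := fc z hz e e0.
split; rewrite /prop_for /continuous_at -fg //.
  apply: cvg_trans f1; apply: near_eq_cvg; near=> t; rewrite fg //.
  by near: t; exact: lt_nbhsr.
apply: cvg_trans f2; apply: near_eq_cvg; near=> t; rewrite fg //.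
by near: t; exact: lt_nbhsr.
Unshelve. all: by end_near.
Qed.

Lemma has_order_cst (k : R[i]) : has_order 0 (fun _ _ => k).
Proof.
split; last by move=> *; exact: ccont_cst.
exists (nr k); first exact: nr_ge0.
move=> e _ z w _ _; rewrite expr0 mulr1 subrr nr0; split=> //.
by rewrite mulr_ge0 ?nr_ge0.
Qed.

Lemma has_order_id : 0 <= c -> has_order 0 (fun z _ => z).
Proof.
move=> c0; split; last by move=> *; exact: ccont_cst.
exists (1 + 2 * c); first by lra.
move=> e _ z w hz hw; rewrite expr0 mulr1; split; last by rewrite mulrDl mul1r lerDl mulr_ge0 ?nr_ge0 // mulr_ge0.
have -> : z = (z - c%:C) + c%:C by rewrite subrK.
apply: le_trans (nrD _ _) _; rewrite nrR ger0_norm //.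
by move: hz; rewrite /halfball; lra.
Qed.

Lemma halfball_lower z : halfball z -> c / 2 <= nr z.
Proof.
move=> hz; have := nrD (c%:C - z) z; rewrite subrK nrR nrC.
by have := ler_norm c; move: hz; rewrite /halfball; lra.
Qed.

Lemma halfball_neq0 z : 0 < c -> halfball z -> z != 0.
Proof. by move=> c0 /halfball_lower h; rewrite -nr_gt0; lra. Qed.

Lemma has_order_inv : 0 < c -> has_order 0 (fun z _ => z^-1).
Proof.
move=> c0; split; last by move=> *; exact: ccont_cst.
have c2 : 0 < 2 / c by rewrite divr_gt0.
have inv_le z : halfball z -> nr z^-1 <= 2 / c.
  move=> /halfball_lower h; rewrite nrV -[2 / c]invrK invf_div lef_pV2 ?posrE //; lra.
exists (2 / c + (2 / c) ^+ 2); first by rewrite addr_ge0 ?sqr_ge0 // ltW.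
move=> e _ z w hz hw; rewrite expr0 mulr1; split.
  by apply: le_trans (inv_le _ hz) _; rewrite lerDl sqr_ge0.
have z0 := halfball_neq0 z c0 hz; have w0 := halfball_neq0 w c0 hw.
have -> : z^-1 - w^-1 = - (z^-1 * w^-1 * (z - w)) by field; rewrite z0 w0.
rewrite nrN nrM ler_wpM2r ?nr_ge0 // nrM.
have := ler_pM (nr_ge0 _) (nr_ge0 _) (inv_le _ hz) (inv_le _ hw).
by rewrite expr2; lra.
Qed.

Lemma has_order_eps : has_order 1 (fun _ e => e%:C).
Proof.
split; last by move=> *; exact: ccont_id.
exists 1 => // e /andP[e0 _] z w _ _; rewrite subrr nr0 nrR gtr0_norm // mul1r.
by split=> //; rewrite mulr_ge0 ?nr_ge0 // ltW.
Qed.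

Lemma has_orderD n f g : has_order n f -> has_order n g ->
  has_order n (fun z e => f z e + g z e).
Proof.
move=> [[K K0 fK] fc] [[L L0 gL] gc]; split; last first.
  by move=> z hz e e0; apply: ccontD; [exact: fc | exact: gc].
exists (K + L); first exact: addr_ge0.
move=> e he z w hz hw; have [f1 f2] := fK e he z w hz hw.
have [g1 g2] := gL e he z w hz hw; split.
  by apply: le_trans (nrD _ _) _; rewrite mulrDl lerD.
rewrite opprD addrACA; apply: le_trans (nrD _ _) _.
by rewrite !mulrDl lerD.
Qed.

Lemma has_orderM m n f g : has_order m f -> has_order n g ->
  has_order (m + n) (fun z e => f z e * g z e).
Proof.
move=> [[K K0 fK] fc] [[L L0 gL] gc]; split; last first.
  by move=> z hz e e0; apply: ccontM; [exact: fc | exact: gc].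
have KL0 : 0 <= K * L by exact: mulr_ge0.
exists (2 * (K * L)); first by rewrite mulr_ge0.
move=> e he z w hz hw; have [f1 f2] := fK e he z w hz hw.
have [g1 g2] := gL e he z w hz hw; have [fw _] := fK e he w w hw hw.
have e0 : 0 <= e by case/andP: he => /ltW.
have E0 : 0 <= K * L * e ^+ (m + n) by rewrite mulr_ge0 // exprn_ge0.
have prod : K * e ^+ m * (L * e ^+ n) = K * L * e ^+ (m + n) by rewrite exprD; ring.
split.
  rewrite nrM; apply: le_trans (ler_pM (nr_ge0 _) (nr_ge0 _) f1 g1) _.
  by rewrite prod; lra.
have -> : f z e * g z e - f w e * g w e = (f z e - f w e) * g z e + f w e * (g z e - g w e) by ring.
apply: le_trans (nrD _ _) _; rewrite !nrM.
have h1 := ler_pM (nr_ge0 _) (nr_ge0 _) f2 g1.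
have h2 := ler_pM (nr_ge0 _) (nr_ge0 _) fw g2.
have p1 : K * e ^+ m * nr (z - w) * (L * e ^+ n) = K * L * e ^+ (m + n) * nr (z - w).
  by rewrite -prod; ring.
have p2 : K * e ^+ m * (L * e ^+ n * nr (z - w)) = K * L * e ^+ (m + n) * nr (z - w).
  by rewrite -prod; ring.
by rewrite p1 in h1; rewrite p2 in h2; lra.
Qed.

Lemma has_orderZ n (k : R[i]) f : has_order n f -> has_order n (fun z e => k * f z e).
Proof. by move=> fo; have := has_orderM 0 n _ _ (has_order_cst k) fo. Qed.

Lemma has_orderN n f : has_order n f -> has_order n (fun z e => - f z e).
Proof.
by move=> /(has_orderZ _ (-1)); apply: has_order_ext => z e _ _; rewrite mulN1r.
Qed.

Lemma has_order_le m n f : (m <= n)%N -> has_order n f -> has_order m f.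
Proof.
move=> mn [[K K0 fK] fc]; split=> //; exists K => // e he z w hz hw.
have [f1 f2] := fK e he z w hz hw; have /andP[e0 e1] := he.
have h : K * e ^+ n <= K * e ^+ m by rewrite ler_wpM2l // ler_wiXn2l // ltW.
split; first exact: le_trans f1 h.
by apply: le_trans f2 _; rewrite ler_wpM2r ?nr_ge0.
Qed.

Lemma has_order_div_eps n f : has_order n.+1 f -> has_order n (fun z e => f z e / e%:C).
Proof.
move=> [[K K0 fK] fc]; split; last first.
  by move=> z hz e e0; apply: ccontM; [exact: fc | exact: ccontVr].
exists K => // e he z w hz hw; have [f1 f2] := fK e he z w hz hw.
have /andP[e0 e1] := he; rewrite -mulrBl !nrM nrV nrR (gtr0_norm e0) !ler_pdivrMr //.
by move: f1 f2; rewrite exprSr => f1 f2; split; [move: f1 | move: f2]; congr (_ <= _); ring.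
Qed.

(** On the disc the argument has size at most [B * e], so [erem_lipschitz] with this radius gives
    [e ^+ n]; the last factor e comes from the argument, or from the difference of two arguments. *)
Lemma has_order_erem n (q : R[i]) : 0 <= c ->
  has_order n.+1 (fun z e => erem n.+1 (q * e%:C * z)).
Proof.
move=> c0; split; last first.
  move=> z hz e e0; apply: ccont_erem; apply: ccontM; last exact: ccont_cst.
  by apply: ccontM; [exact: ccont_cst | exact: ccont_id].
pose B := nr q * (2 * c).
have q0 := nr_ge0 q.
have B0 : 0 <= B by rewrite !mulr_ge0.
have [K K0 HK] := erem_lipschitz n B B0.
have Bn : 0 <= B ^+ n by exact: exprn_ge0.
exists (K * B ^+ n * (B + nr q)); first by rewrite !mulr_ge0 // addr_ge0.
move=> e he z w hz hw; have /andP[e0 e1] := he.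
have arg x : halfball x -> nr (q * e%:C * x) <= B * e.
  move=> hx; rewrite !nrM nrR gtr0_norm // /B -mulrA -[leRHS]mulrA ler_wpM2l //.
  rewrite mulrC (ler_wpM2r (ltW e0)) //.
  have -> : x = (x - c%:C) + c%:C by rewrite subrK.
  apply: le_trans (nrD _ _) _; rewrite nrR ger0_norm //.
  by move: hx; rewrite /halfball; lra.
have Be0 : 0 <= B * e by rewrite mulr_ge0 // ltW.
have BeB : B * e <= B by rewrite ler_piMr.
have en : 0 <= e ^+ n.+1 by rewrite exprn_ge0 // ltW.
have pos : 0 <= K * (B * e) ^+ n by rewrite mulr_ge0 // exprn_ge0.
split.
  have := HK (B * e) _ 0 BeB (arg z hz); rewrite nr0 erem0 !subr0 => /(_ Be0) h.
  apply: le_trans h _; apply: le_trans (ler_wpM2l pos (arg z hz)) _.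
  have -> : K * (B * e) ^+ n * (B * e) = K * B ^+ n * B * e ^+ n.+1.
    by rewrite exprMn exprS; ring.
  by rewrite ler_wpM2r // ler_wpM2l ?mulr_ge0 // lerDl; exact: nr_ge0.
apply: le_trans (HK (B * e) _ _ BeB (arg z hz) (arg w hw)) _.
rewrite -mulrBr !nrM nrR gtr0_norm //.
have -> : K * (B * e) ^+ n * (nr q * e * nr (z - w)) = K * B ^+ n * nr q * e ^+ n.+1 * nr (z - w).
  by rewrite exprMn exprS; ring.
by rewrite ler_wpM2r ?nr_ge0 // ler_wpM2r // ler_wpM2l ?mulr_ge0 // lerDr.
Qed.

(** At [e = 0] the function has the root [c] with slope [G c]. The first-order guess [c + e lam],
    with [lam = - L c / G c], leaves a residual O(e^2), and the contraction finds a root within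
    O(e^2) of it. *)
Lemma perturbed_root (G L : R[i] -> R[i]) (S : R[i] -> R -> R[i]) : 0 < c ->
  has_order 0 (fun z _ => G z) -> has_order 0 (fun z _ => L z) -> has_order 2 S ->
  G c%:C != 0 ->
  exists (e1 K : R) (zeta : R -> R[i]), [/\ 0 < e1, e1 <= 1,
    forall e, 0 < e < e1 -> halfball (zeta e),
    forall e, 0 < e < e1 ->
      (zeta e - c%:C) * G (zeta e) + e%:C * L (zeta e) + S (zeta e) e = 0 /\
      nr (zeta e - (c%:C - e%:C * (L c%:C / G c%:C))) <= K * e ^+ 2 &
    forall e, 0 < e < e1 -> ccont e zeta].
Proof.
move=> c0 [[KG KG0 GK] _] [[KL KL0 LK] _] [[KS KS0 SK] Sc] a0.
set a := G c%:C in a0 *; set lam := - (L c%:C / a).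
have na0 : 0 < nr a by rewrite nr_gt0.
pose H z (e : R) := (z - c%:C) * G z + e%:C * L z + S z e.
have hc : halfball c%:C by rewrite /halfball subrr nr0; lra.
have GK' z w : halfball z -> halfball w -> nr (G z - G w) <= KG * nr (z - w).
  move=> hz hw; have [|_] := GK 1 _ z w hz hw; first by rewrite ltr01 lexx.
  by rewrite mulr1.
have LK' z w : halfball z -> halfball w -> nr (L z - L w) <= KL * nr (z - w).
  move=> hz hw; have [|_] := LK 1 _ z w hz hw; first by rewrite ltr01 lexx.
  by rewrite mulr1.
pose K := KG + KL + KS + 1.
have K0 : 0 < K by rewrite /K; lra.
(* [rho] limits the variation of [G]: its two contributions to the Lipschitz defect total at most a
   quarter of [nr a]. *)
pose rho := Num.min (c / 2) (nr a / (8 * K)).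
have rho0 : 0 < rho by rewrite lt_min !divr_gt0 ?mulr_gt0.
have rhoc : rho <= c / 2 by rewrite ge_min lexx.
have rhoK : rho * (8 * K) <= nr a by rewrite -ler_pdivlMr ?mulr_gt0 // ge_min lexx orbT.
(* [M * e ^+ 2] bounds the value of [H] at the first-order guess. *)
pose M := (nr lam * KG + KL) * nr lam + KS.
have lam0 := nr_ge0 lam.
have M0 : 0 <= M by rewrite /M addr_ge0 // mulr_ge0 // addr_ge0 // mulr_ge0.
pose D := nr lam + 2 * (M / nr a) + 1.
have Ma0 : 0 <= M / nr a by rewrite divr_ge0 // ltW.
have D0 : 0 < D by rewrite /D; lra.
(* The three bounds give, in order: validity of the uniform estimates, a second quarter of [nr a]
   for the terms in [L] and [S], and inclusion of the contraction disc in the disc of radius [rho]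
   (through [D]). *)
pose e1 := Num.min 1 (Num.min (nr a / (4 * K)) (rho / D)).
have e10 : 0 < e1 by rewrite !lt_min ltr01 !divr_gt0 ?mulr_gt0.
have small e : 0 < e < e1 -> [/\ e <= 1, e * (4 * K) <= nr a & e * D <= rho].
  rewrite !lt_min => /and4P[_ h1 h2 h3]; split; first exact: ltW.
    by rewrite -ler_pdivlMr ?mulr_gt0 // ltW.
  by rewrite -ler_pdivlMr // ltW.
have ball_sub z : nr (z - c%:C) <= rho -> halfball z by move=> h; exact: le_trans h rhoc.
have Hlip e z w : 0 < e < e1 -> nr (z - c%:C) <= rho -> nr (w - c%:C) <= rho ->
    nr (H z e - H w e - a * (z - w)) <= nr a / 2 * nr (z - w).
  move=> he hz hw; have [le1 e4 _] := small e he; have /andP[e0 _] := he.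
  have zb := ball_sub _ hz; have wb := ball_sub _ hw.
  have -> : H z e - H w e - a * (z - w) = (z - w) * (G z - a) + (w - c%:C) * (G z - G w)
      + e%:C * (L z - L w) + (S z e - S w e) by rewrite /H; ring.
  set d := nr (z - w); have d0 : 0 <= d by exact: nr_ge0.
  have t1 : nr ((z - w) * (G z - a)) <= d * (KG * rho).
    rewrite nrM ler_wpM2l //; apply: le_trans (GK' _ _ zb hc) _; exact: ler_wpM2l.
  have t2 : nr ((w - c%:C) * (G z - G w)) <= rho * (KG * d).
    by rewrite nrM ler_pM ?nr_ge0 //; exact: GK'.
  have t3 : nr (e%:C * (L z - L w)) <= e * (KL * d).
    by rewrite nrM nrR gtr0_norm // (ler_wpM2l (ltW e0)) //; exact: LK'.
  have t4 : nr (S z e - S w e) <= e * (KS * d).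
    have [|_ h] := SK e _ z w zb wb; first by rewrite e0 le1.
    apply: le_trans h _; have -> : KS * e ^+ 2 * nr (z - w) = e * (e * (KS * d)) by rewrite /d; ring.
    rewrite ler_wpM2l ?(ltW e0) // ler_piMl // mulr_ge0 //.
  apply: le_trans (nrD _ _) _; apply: le_trans (lerD (nrD _ _) (lexx _)) _.
  apply: le_trans (lerD (lerD (nrD _ _) (lexx _)) (lexx _)) _.
  have b1 : 2 * (KG * rho) <= nr a / 4.
    have : 0 <= rho * (KL + KS + 1) by rewrite mulr_ge0 ?(ltW rho0) //; lra.
    by move: rhoK; rewrite /K; lra.
  have b2 : e * (KL + KS) <= nr a / 4.
    have : 0 <= e * (KG + 1) by rewrite mulr_ge0 ?(ltW e0) //; lra.
    by move: e4; rewrite /K; lra.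
  have b1' := ler_wpM2l d0 b1; have b2' := ler_wpM2l d0 b2.
  by lra.
have sol e : 0 < e < e1 -> exists2 z, nr (z - (c%:C + e%:C * lam)) <= 2 * (M / nr a * e ^+ 2)
    & H z e = 0 /\ nr (z - c%:C) <= rho.
  move=> he; have [le1 e4 eD] := small e he; have /andP[e0 _] := he.
  set z0 := c%:C + e%:C * lam; set eta := M / nr a * e ^+ 2.
  have eta0 : 0 <= eta by rewrite mulr_ge0 ?sqr_ge0.
  have z0c : nr (z0 - c%:C) <= e * nr lam.
    by rewrite /z0 addrC addKr nrM nrR gtr0_norm.
  have etae : eta <= M / nr a * e by rewrite /eta ler_wpM2l // expr2 ler_piMl // ltW.
  have inball z : nr (z - z0) <= 2 * eta -> nr (z - c%:C) <= rho.
    move=> h; have -> : z - c%:C = (z - z0) + (z0 - c%:C) by ring.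
    apply: le_trans (nrD _ _) _; apply: le_trans eD; rewrite /D; nra.
  have z0b : nr (z0 - c%:C) <= rho by apply: inball; rewrite subrr nr0; lra.
  have z0h := ball_sub _ z0b.
  have Hz0 : nr (H z0 e) <= nr a * eta.
    have -> : nr a * eta = M * e ^+ 2 by rewrite /eta; field; rewrite gt_eqF.
    have -> : H z0 e = e%:C * (lam * (G z0 - a) + (L z0 - L c%:C)) + S z0 e.
      rewrite /H {1}/z0; have : lam * a = - L c%:C by rewrite /lam mulNr divfK.
      move=> hl; ring: hl.
    have [|s1 _] := SK e _ z0 z0 z0h z0h; first by rewrite e0 le1.
    apply: le_trans (nrD _ _) _; rewrite nrM nrR gtr0_norm //.
    have g1 : nr (G z0 - a) <= KG * (e * nr lam).
      by apply: le_trans (GK' _ _ z0h hc) _; rewrite ler_wpM2l.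
    have l1 : nr (L z0 - L c%:C) <= KL * (e * nr lam).
      by apply: le_trans (LK' _ _ z0h hc) _; rewrite ler_wpM2l.
    have := nrD (lam * (G z0 - a)) (L z0 - L c%:C); rewrite nrM => h.
    have g2 := ler_wpM2l lam0 g1.
    have h2 : nr (lam * (G z0 - a) + (L z0 - L c%:C)) <= nr lam * (KG * (e * nr lam)) + KL * (e * nr lam).
      by apply: le_trans h _; exact: lerD.
    have h3 := ler_wpM2l (ltW e0) h2.
    by rewrite /M; lra.
  have [z zb Hz] := contraction_root (H^~ e) a z0 eta a0 eta0
    (fun z w hz hw => Hlip e z w he (inball _ hz) (inball _ hw)) Hz0.
  by exists z => //; split=> //; exact: inball.
pose zeta e : R[i] := match pselect (0 < e < e1) with
  | left h => s2val (cid2 (sol e h)) | right _ => 0 end.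
have zetaP e : 0 < e < e1 -> nr (zeta e - (c%:C + e%:C * lam)) <= 2 * (M / nr a * e ^+ 2)
    /\ H (zeta e) e = 0 /\ nr (zeta e - c%:C) <= rho.
  by move=> he; rewrite /zeta; case: pselect => // h; case: cid2.
exists e1, (2 * (M / nr a)), zeta; split=> //.
- by rewrite ge_min lexx.
- by move=> e /zetaP[_ [_ h]]; exact: ball_sub.
- move=> e /zetaP[h1 [h2 _]]; split=> //.
  by rewrite -mulrA; move: h1; rewrite /lam mulrN.
move=> e he; have [_ [He zb]] := zetaP e he; have /andP[e0 ee1] := he.
have Hcont : ccont e (fun s => H (zeta e) s).
  apply: ccontD; last by apply: Sc => //; exact: ball_sub.
  apply: ccontD; first exact: ccont_cst.
  by apply: ccontM; [exact: ccont_id | exact: ccont_cst].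
(* Because [zeta s] is a root at parameter [s], the distance between two roots is controlled by the
   value of [H] at the old root and new parameter. So continuity in e at fixed z is all that is
   required. *)
have dist s : 0 < s < e1 -> nr (zeta e - zeta s) <= 2 / nr a * nr (H (zeta e) s).
  move=> hs; have [_ [Hs sb]] := zetaP s hs.
  have := Hlip s (zeta e) (zeta s) hs zb sb; rewrite Hs subr0 => h.
  have h2 := nrB (H (zeta e) s) (H (zeta e) s - a * (zeta e - zeta s)).
  rewrite opprB addrC subrK nrM in h2.
  rewrite mulrAC ler_pdivlMr //; lra.
have key (x : R) : 0 < x -> \forall s \near e, nr (zeta e - zeta s) < x.
  move=> x0; have y0 : 0 < x * nr a / 4 by rewrite divr_gt0 // mulr_gt0.
  have [/cvgrPdist_lt/(_ _ y0) c1 /cvgrPdist_lt/(_ _ y0) c2] := Hcont.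
  near=> s.
  have hs : 0 < s < e1.
    apply/andP; split; near: s; [exact: lt_nbhsr | exact: lt_nbhsl].
  apply: le_lt_trans (dist s hs) _.
  rewrite mulrAC ltr_pdivrMr // mulrC.
  have : `|complex.Re (H (zeta e) s)| < x * nr a / 4.
    by rewrite -normrN -sub0r -[0]/(complex.Re (0 : R[i])) -He; near: s.
  have : `|complex.Im (H (zeta e) s)| < x * nr a / 4.
    by rewrite -normrN -sub0r -[0]/(complex.Im (0 : R[i])) -He; near: s.
  by have := ler_nr (H (zeta e) s); lra.
split; apply/cvgrPdist_lt => x x0.
  apply: filterS (key x x0) => s; apply: le_lt_trans.
  by rewrite -Re_opp -Re_add; exact: ler_Re_nr.
apply: filterS (key x x0) => s; apply: le_lt_trans.
by rewrite -Im_opp -Im_add; exact: ler_Im_nr.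
Unshelve. all: by end_near.
Qed.

End UniformOrder.

(** * Transfer of a state through one shell and its low-frequency limit *)

Section ShellTransfer.
Context {R : realType}.
Implicit Types (k p a b U F : R[i]).

(* State at [|x| = b] of the solution with wave number [k] whose state at [|x| = a] is
   [(U, F)], that is [u = U] and [u' = p F].  For [a = 0], [U = 1], this is the solution
   regular at the origin. *)
Definition shellU k p a b U F : R[i] :=
  (a * U * ccos (k * (b - a)) + (U + a * p * F) * (csin (k * (b - a)) / k)) / b.

Definition shellF k p a b U F : R[i] :=
  (U * (- (a * b * (k * csin (k * (b - a)))) + (b - a) * ccos (k * (b - a))
        - csin (k * (b - a)) / k)
   + a * p * F * (b * ccos (k * (b - a)) - csin (k * (b - a)) / k)) / (p * b ^+ 2).

(** Symmetrisation removes the cubic term for the cosine and the quartic one for the sine, so orders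
    4 and 5 are reached after subtracting only the quadratic and cubic Taylor polynomials. *)
Definition cosR (x : R[i]) := (erem 4 ('i * x) + erem 4 (- ('i * x))) / 2.
Definition sinR (x : R[i]) := (erem 5 ('i * x) - erem 5 (- ('i * x))) / (2 * 'i).

Lemma i_neq0 : 'i != 0 :> R[i].
Proof. by rewrite -nr_gt0 nri. Qed.

Lemma ccosE (x : R[i]) : ccos x = 1 - x ^+ 2 / 2 + cosR x.
Proof.
rewrite /ccos /cosR /erem !big_ord_recl !big_ord0 /= /bump /= !addn0 !add1n.
have -> : 3`! = 6%N by [].
have -> : 2`! = 2%N by [].
have -> : 1`! = 1%N by [].
have -> : 0`! = 1%N by [].
by have i2 := @sqri R; field: i2.
Qed.

Lemma csinE (x : R[i]) : csin x = x - x ^+ 3 / 6 + sinR x.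
Proof.
rewrite /csin /sinR /erem !big_ord_recl !big_ord0 /= /bump /= !addn0 !add1n.
have -> : 4`! = 24%N by [].
have -> : 3`! = 6%N by [].
have -> : 2`! = 2%N by [].
have -> : 1`! = 1%N by [].
have -> : 0`! = 1%N by [].
by have i2 := @sqri R; field: i2; exact: i_neq0.
Qed.

Variable c : R.
Hypothesis c0 : 0 < c.
Local Notation order := (has_order c).

Lemma order_cosR (q : R[i]) : order 4 (fun z e => cosR (q * e%:C * z)).
Proof.
have h1 := has_order_erem c 3 ('i * q) (ltW c0).
have h2 := has_order_erem c 3 (- ('i * q)) (ltW c0).
apply: has_order_ext (has_orderZ c _ 2^-1 _ (has_orderD c _ _ _ h1 h2)) => z e _ _.
by rewrite /cosR mulrC !mulNr !mulrA.
Qed.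

Lemma order_sinR (q : R[i]) : order 5 (fun z e => sinR (q * e%:C * z)).
Proof.
have h1 := has_order_erem c 4 ('i * q) (ltW c0).
have h2 := has_order_erem c 4 (- ('i * q)) (ltW c0).
apply: has_order_ext (has_orderZ c _ (2 * 'i)^-1 _ (has_orderD c _ _ _ h1 (has_orderN c _ _ h2))) => z e _ _.
by rewrite /sinR mulrC !mulNr !mulrA.
Qed.

(** Equality modulo O(e^2). Boundedness of both sides is included to make the relation stable under
    products, so limits of composed transfers reduce to algebra. *)
Definition agree2 (f g : R[i] -> R -> R[i]) :=
  [/\ order 0 f, order 0 g & order 2 (fun z e => f z e - g z e)].

Lemma agree2_refl f : order 0 f -> agree2 f f.
Proof.
move=> fo; split=> //; split.
  by exists 0 => // e _ z w _ _; rewrite !subrr nr0 !mul0r.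
move=> z hz e e0; have -> : (fun e => f z e - f z e) = (fun=> 0) by apply/funext => x; rewrite subrr.
exact: ccont_cst.
Qed.

Lemma agree2_cst (x : R[i]) : agree2 (fun _ _ => x) (fun _ _ => x).
Proof. by apply: agree2_refl; exact: has_order_cst. Qed.

Lemma agree2D f g f' g' : agree2 f f' -> agree2 g g' ->
  agree2 (fun z e => f z e + g z e) (fun z e => f' z e + g' z e).
Proof.
move=> [f1 f2 f3] [g1 g2 g3]; split; [exact: has_orderD|exact: has_orderD|].
by apply: has_order_ext (has_orderD _ _ _ _ f3 g3) => z e _ _; ring.
Qed.

Lemma agree2M f g f' g' : agree2 f f' -> agree2 g g' ->
  agree2 (fun z e => f z e * g z e) (fun z e => f' z e * g' z e).
Proof.
move=> [f1 f2 f3] [g1 g2 g3]; split; [exact: (has_orderM _ 0 0)|exact: (has_orderM _ 0 0)|].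
have := has_orderD _ _ _ _ (has_orderM _ _ _ _ _ f3 g1) (has_orderM _ 0 2 _ _ f2 g3).
by apply: has_order_ext => z e _ _; ring.
Qed.

Lemma agree2B f g f' g' : agree2 f f' -> agree2 g g' ->
  agree2 (fun z e => f z e - g z e) (fun z e => f' z e - g' z e).
Proof.
move=> [f1 f2 f3] [g1 g2 g3]; split.
- exact: has_orderD f1 (has_orderN _ _ _ g1).
- exact: has_orderD f2 (has_orderN _ _ _ g2).
by apply: has_order_ext (has_orderD _ _ _ _ f3 (has_orderN _ _ _ g3)) => z e _ _; ring.
Qed.

Lemma agree2_ext f f' g g' :
  (forall z e, halfball c z -> 0 < e -> f z e = g z e) ->
  (forall z e, halfball c z -> 0 < e -> f' z e = g' z e) ->
  agree2 f f' -> agree2 g g'.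
Proof.
move=> fg fg' [f1 f2 f3]; split.
- exact: has_order_ext f1.
- exact: has_order_ext f2.
by apply: has_order_ext f3 => z e hz e0; rewrite fg // fg'.
Qed.

Lemma agree2_remainder f g h : order 0 g -> order 2 h ->
  (forall z e, halfball c z -> 0 < e -> f z e = g z e + h z e) -> agree2 f g.
Proof.
move=> go ho fE; split.
- apply: has_order_ext (has_orderD c _ _ _ go (has_order_le c 0 2 _ isT ho)) => z e hz e0.
  by rewrite fE.
- exact: go.
- by apply: has_order_ext ho => z e hz e0; rewrite fE // addrC addKr.
Qed.

Variables (v : R) (v0 : 0 < v).

Lemma realC_neq0 (x : R) : 0 < x -> x%:C != 0 :> R[i].
Proof. by move=> x0; rewrite fmorph_eq0 gt_eqF. Qed.

Lemma wavenumber_neq0 z (e : R) : halfball c z -> 0 < e -> e%:C * z / v%:C != 0.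
Proof.
move=> hz e0; rewrite !mulf_neq0 ?invr_eq0 ?realC_neq0 //.
exact: halfball_neq0 hz.
Qed.

Let k z (e : R) := e%:C * z / v%:C.

Lemma order_wavenumber_sqr : order 2 (fun z e => k z e ^+ 2).
Proof.
have h1 : order 1 k.
  have := has_orderM _ _ _ _ _
    (has_orderM _ _ _ _ _ (has_order_eps c) (has_order_id c (ltW c0)))
    (has_order_cst c (v%:C)^-1).
  by apply: has_order_ext.
exact: (has_orderM _ 1 1 _ _ h1 h1).
Qed.

Lemma order_cosR_wavenumber (l : R[i]) : order 4 (fun z e => cosR (k z e * l)).
Proof.
apply: has_order_ext (order_cosR (l / v%:C)) => z e _ _.
by congr cosR; rewrite /k; ring.
Qed.

Lemma order_sinR_wavenumber (l : R[i]) : order 4 (fun z e => sinR (k z e * l) / k z e).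
Proof.
have h := has_order_div_eps _ _ _ (has_orderM _ _ _ _ _ (order_sinR (l / v%:C))
  (has_orderZ _ _ v%:C _ (has_order_inv c c0))).
apply: has_order_ext h => z e hz e0.
have z0 := halfball_neq0 c z c0 hz.
have -> : l / v%:C * e%:C * z = k z e * l by rewrite /k; ring.
by rewrite /k; field; rewrite z0 !realC_neq0.
Qed.

Lemma agree2_ccos (l : R[i]) : agree2 (fun z e => ccos (k z e * l)) (fun _ _ => 1).
Proof.
apply: (agree2_remainder _ _ (fun z e => k z e ^+ 2 * (- l ^+ 2 / 2) + cosR (k z e * l))).
- exact: has_order_cst.
- apply: has_orderD; last exact: has_order_le (order_cosR_wavenumber l).
  exact: (has_orderM _ 2 0 _ _ order_wavenumber_sqr (has_order_cst _ _)).
- by move=> z e _ _; rewrite ccosE; field.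
Qed.

Lemma agree2_csin (l : R[i]) : agree2 (fun z e => csin (k z e * l) / k z e) (fun _ _ => l).
Proof.
apply: (agree2_remainder _ _
  (fun z e => k z e ^+ 2 * (- l ^+ 3 / 6) + sinR (k z e * l) / k z e)).
- exact: has_order_cst.
- apply: has_orderD; last exact: has_order_le (order_sinR_wavenumber l).
  exact: (has_orderM _ 2 0 _ _ order_wavenumber_sqr (has_order_cst _ _)).
move=> z e hz e0; have := wavenumber_neq0 z e hz e0.
by rewrite csinE -/(k z e) => h; field.
Qed.

Lemma agree2_k_csin (l : R[i]) : agree2 (fun z e => k z e * csin (k z e * l)) (fun _ _ => 0).
Proof.
have [h _ _] := agree2_csin l.
apply: (agree2_remainder _ _ _ (has_order_cst _ _)
  (has_orderM _ 2 0 _ _ order_wavenumber_sqr h)).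
move=> z e hz e0; have := wavenumber_neq0 z e hz e0.
by rewrite -/(k z e) => k0; field.
Qed.

Variables (U F U' F' : R[i] -> R -> R[i]).
Hypotheses (UU : agree2 U U') (FF : agree2 F F').
Variables (a b : R) (b0 : 0 < b).

Let b_neq0 : b%:C != 0 :> R[i].
Proof. exact: realC_neq0. Qed.

(** As k tends to 0 the solution becomes harmonic, of the form A + B/|x|: its flux decays like the
    inverse square of the radius, and U gains the integral of that flux. *)
Lemma shellU_background :
  agree2 (fun z e => shellU (k z e) 1 a%:C b%:C (U z e) (F z e))
         (fun z e => U' z e + F' z e * (a * (b - a) / b)%:C).
Proof.
have h := agree2M _ _ _ _ (agree2D _ _ _ _
  (agree2M _ _ _ _ (agree2M _ _ _ _ (agree2_cst a%:C) UU) (agree2_ccos (b%:C - a%:C)))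
  (agree2M _ _ _ _ (agree2D _ _ _ _ UU (agree2M _ _ _ _ (agree2_cst (a%:C * 1)) FF)) (agree2_csin (b%:C - a%:C))))
  (agree2_cst (b%:C)^-1).
apply: agree2_ext h => // z e _ _.
by rewrite !rmorphM fmorphV rmorphB /=; field.
Qed.

Lemma shellF_background :
  agree2 (fun z e => shellF (k z e) 1 a%:C b%:C (U z e) (F z e))
         (fun z e => F' z e * (a ^+ 2 / b ^+ 2)%:C).
Proof.
have h := agree2M _ _ _ _ (agree2D _ _ _ _
  (agree2M _ _ _ _ UU (agree2B _ _ _ _ (agree2D _ _ _ _
     (agree2M _ _ _ _ (agree2_cst (- (a%:C * b%:C))) (agree2_k_csin (b%:C - a%:C)))
     (agree2M _ _ _ _ (agree2_cst (b%:C - a%:C)) (agree2_ccos (b%:C - a%:C))))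
     (agree2_csin (b%:C - a%:C))))
  (agree2M _ _ _ _ (agree2M _ _ _ _ (agree2_cst (a%:C * 1)) FF)
    (agree2B _ _ _ _ (agree2M _ _ _ _ (agree2_cst b%:C) (agree2_ccos (b%:C - a%:C))) (agree2_csin (b%:C - a%:C)))))
  (agree2_cst (1 * b%:C ^+ 2)^-1).
apply: agree2_ext h => z e _ _; first by rewrite /shellF mulNr.
by rewrite !rmorphM fmorphV !rmorphXn /=; field.
Qed.

Lemma shellU_resonator :
  agree2 (fun z e => shellU (k z e) (e ^+ 2)%:C a%:C b%:C (U z e) (F z e)) U'.
Proof.
have e2 : order 2 (fun _ e => (e ^+ 2)%:C).
  have := has_orderM _ 1 1 _ _ (has_order_eps c) (has_order_eps c).
  by apply: has_order_ext => z e _ _; rewrite rmorphXn.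
have p0 : agree2 (fun _ e => (e ^+ 2)%:C) (fun _ _ => 0).
  apply: (agree2_remainder _ _ _ (has_order_cst _ _) e2) => z e _ _.
  by rewrite add0r.
have h := agree2M _ _ _ _ (agree2D _ _ _ _
  (agree2M _ _ _ _ (agree2M _ _ _ _ (agree2_cst a%:C) UU) (agree2_ccos (b%:C - a%:C)))
  (agree2M _ _ _ _ (agree2D _ _ _ _ UU (agree2M _ _ _ _ (agree2M _ _ _ _ (agree2_cst a%:C) p0) FF)) (agree2_csin (b%:C - a%:C))))
  (agree2_cst (b%:C)^-1).
by apply: agree2_ext h => // z e _ _; field.
Qed.

(** Integrating [(s^2 u')' = - k^2 s^2 u] over the shell with u nearly constant gives the increment
    [- k^2 U (b^3 - a^3) / 3] of [s^2 u']; since [u' = e^2 F] and [k = e z / v], the factors [e^2]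
    cancel and a term of order one remains. *)
Lemma shellF_resonator :
  agree2 (fun z e => shellF (k z e) (e ^+ 2)%:C a%:C b%:C (U z e) (F z e))
         (fun z e => F' z e * (a ^+ 2 / b ^+ 2)%:C
            - z ^+ 2 * U' z e * ((b ^+ 3 - a ^+ 3) / (3 * v ^+ 2 * b ^+ 2))%:C).
Proof.
set l := b%:C - a%:C : R[i].
have [sn0 _ sn1] := agree2_csin l.
pose mu z := z ^+ 2 / v%:C ^+ 2.
have muo : order 0 (fun z _ => mu z).
  have zo := has_order_id c (ltW c0).
  exact: (has_orderM _ 0 0 _ _ (has_orderM _ 0 0 _ _ zo zo) (has_order_cst _ _)).
(* What the coefficient of [U] retains beyond its quadratic Taylor term: it has order 4, hence order
   2 after the division by [e ^+ 2]. *)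
pose rest z e := - (a%:C * b%:C) * (k z e ^+ 2 * (csin (k z e * l) / k z e - l))
  + (l * cosR (k z e * l) - sinR (k z e * l) / k z e).
have resto : order 4 rest.
  apply: has_orderD.
    exact: has_orderZ (has_orderM _ 2 2 _ _ order_wavenumber_sqr sn1).
  apply: has_orderD; first exact: has_orderZ (order_cosR_wavenumber l).
  exact: has_orderN (order_sinR_wavenumber l).
pose X z e := (- (a%:C * b%:C * (k z e * csin (k z e * l))) + l * ccos (k z e * l)
  - csin (k z e * l) / k z e) / (e ^+ 2)%:C.
have Xa : agree2 X (fun z _ => mu z * (- (b%:C ^+ 3 - a%:C ^+ 3) / 3)).
  apply: (agree2_remainder _ _ (fun z e => rest z e / e%:C / e%:C)).
  - exact: (has_orderM _ 0 0 _ _ muo (has_order_cst _ _)).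
  - by apply: has_order_div_eps; exact: has_order_div_eps.
  move=> z e hz e0; have k0 : k z e != 0 by exact: wavenumber_neq0.
  have zE : z = k z e * v%:C / e%:C by rewrite /k; field; rewrite !realC_neq0.
  rewrite /X /rest /mu; move: (k z e) k0 zE => kk k0 ->.
  rewrite csinE ccosE /l rmorphXn /=.
  by field; rewrite k0 !realC_neq0.
have h := agree2M _ _ _ _ (agree2D _ _ _ _ (agree2M _ _ _ _ UU Xa)
  (agree2M _ _ _ _ (agree2M _ _ _ _ (agree2_cst a%:C) FF)
    (agree2B _ _ _ _ (agree2M _ _ _ _ (agree2_cst b%:C) (agree2_ccos l)) (agree2_csin l))))
  (agree2_cst (b%:C ^+ 2)^-1).
apply: agree2_ext h => z e hz e0.
  have k0 : k z e != 0 by exact: wavenumber_neq0.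
  rewrite /shellF /X -/l rmorphXn /=; move: (ccos _) (csin _) => co si.
  by move: (k z e) k0 => kk k0; field; rewrite b_neq0 k0 realC_neq0.
rewrite /mu /l !(rmorphM, fmorphV, rmorphXn, rmorphB) /= rmorph_nat.
by field; rewrite b_neq0 realC_neq0.
Qed.

End ShellTransfer.

(** * Spherical wave coefficients of a layer solution *)

Section Kernel.
Context {R : realType}.
Implicit Types (x y k p a b U F : R[i]).

Lemma cexp_ccos_csin x : cexp ('i * x) = ccos x + 'i * csin x.
Proof. by rewrite /ccos /csin; field; exact: i_neq0. Qed.

Lemma ccos2Dcsin2 x : ccos x ^+ 2 + csin x ^+ 2 = 1.
Proof.
have i2 := @sqri R; rewrite /ccos /csin cexpN.
by have e0 := cexp_neq0 ('i * x); field: i2; rewrite e0 i_neq0.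
Qed.

Lemma ccosB x y : ccos (x - y) = ccos x * ccos y + csin x * csin y.
Proof.
have i2 := @sqri R; rewrite /ccos /csin !mulrBr !opprB !cexpD !cexpN.
have ex := cexp_neq0 ('i * x); have ey := cexp_neq0 ('i * y).
by field: i2; rewrite ex ey i_neq0.
Qed.

Lemma csinB x y : csin (x - y) = csin x * ccos y - ccos x * csin y.
Proof.
have i2 := @sqri R; rewrite /ccos /csin !mulrBr !opprB !cexpD !cexpN.
have ex := cexp_neq0 ('i * x); have ey := cexp_neq0 ('i * y).
by field: i2; rewrite ex ey i_neq0.
Qed.

(* The solution with state [(U, F)] at [|x| = a] is
   [(layer_sin sin (k |x|) + layer_cos cos (k |x|)) / (k |x|)], and [layerJ], [layerH] are its
   coefficients on [j_0] and [h_0^(1)]. *)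
Definition layer_sin k p a U F : R[i] :=
  k * (a * U) * csin (k * a) + (U + a * p * F) * ccos (k * a).
Definition layer_cos k p a U F : R[i] :=
  k * (a * U) * ccos (k * a) - (U + a * p * F) * csin (k * a).
Definition layerJ k p a U F := layer_sin k p a U F - 'i * layer_cos k p a U F.
Definition layerH k p a U F := 'i * layer_cos k p a U F.

Lemma layer_value s t x : x != 0 ->
  sbh x * ('i * t) + sbj x * (s - 'i * t) = (s * csin x + t * ccos x) / x.
Proof.
move=> x0; rewrite /sbj /sbh cexp_ccos_csin; have i2 := @sqri R.
by field: i2.
Qed.

Lemma layer_deriv s t x : x != 0 ->
  sbh' x * ('i * t) + sbj' x * (s - 'i * t) =
  (s * ccos x - t * csin x) / x - (s * csin x + t * ccos x) / x ^+ 2.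
Proof.
move=> x0; rewrite /sbj' /sbh' cexp_ccos_csin; have i2 := @sqri R.
by field: i2.
Qed.

Variables (k p : R[i]) (k0 : k != 0).

(** At the inner radius the identity cos^2 + sin^2 = 1 inverts the definition of the coefficients.
    Together with [layer_outer] this expresses the state on both sides of an interface by entries of
    the matrix. *)
Lemma layer_inner a U F : a != 0 ->
  sbh (k * a) * layerH k p a U F + sbj (k * a) * layerJ k p a U F = U /\
  sbh' (k * a) * layerH k p a U F + sbj' (k * a) * layerJ k p a U F = p * F / k.
Proof.
move=> a0; have ka : k * a != 0 by rewrite mulf_neq0.
rewrite layer_value // layer_deriv // /layer_sin /layer_cos.
have := ccos2Dcsin2 (k * a); move: (ccos _) (csin _) => C S /(canRL (addrK _)) h.
by split; field: h; rewrite k0 a0.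
Qed.

(** The addition formulas for [k * (b - a)] turn the wave expansion into the shell transfer. *)
Lemma layer_outer a b U F : b != 0 -> p != 0 ->
  sbh (k * b) * layerH k p a U F + sbj (k * b) * layerJ k p a U F = shellU k p a b U F /\
  sbh' (k * b) * layerH k p a U F + sbj' (k * b) * layerJ k p a U F
    = p * shellF k p a b U F / k.
Proof.
move=> b0 p0; have kb : k * b != 0 by rewrite mulf_neq0.
rewrite layer_value // layer_deriv // /layer_sin /layer_cos /shellU /shellF.
rewrite !(mulrBr k) ccosB csinB.
move: (ccos (k * a)) (csin (k * a)) (ccos (k * b)) (csin (k * b)) => *.
by split; field; rewrite k0 b0 ?p0.
Qed.

End Kernel.

(** * From the outgoing condition to a kernel vector *)

Section Determinant.
Context {R : realType}.

Lemma det_eq0_kernel n (A : 'M[R[i]]_n) (x : nat -> R[i]) (i0 : 'I_n) :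
  x i0 != 0 -> (forall i, \sum_(j < n) A i j * x j = 0) -> \det A = 0.
Proof.
move=> x0 Ax; rewrite -det_tr; apply/eqP/det0P; exists (\row_j x j).
  by apply/eqP => /rowP /(_ i0); rewrite !mxE; apply/eqP.
apply/rowP => i; rewrite !mxE -[RHS](Ax i); apply: eq_bigr => j _.
by rewrite !mxE mulrC.
Qed.

Lemma eq0_of_eq (A B T : R[i]) : A = B -> T = A - B -> T = 0.
Proof. by move=> -> ->; rewrite subrr. Qed.

Lemma sum_nat6 (f : nat -> R[i]) : \sum_(j < 3.*2) f j =
  f 0%N + f 1%N + f 2%N + f 3%N + f 4%N + f 5%N.
Proof. by rewrite -(big_mkord xpredT) unlock /= addr0 !addrA. Qed.

Lemma sum_nat8 (f : nat -> R[i]) : \sum_(j < 4.*2) f j =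
  f 0%N + f 1%N + f 2%N + f 3%N + f 4%N + f 5%N + f 6%N + f 7%N.
Proof. by rewrite -(big_mkord xpredT) unlock /= addr0 !addrA. Qed.

Variables (vr v : R) (vr0 : 0 < vr) (v0 : 0 < v) (r : nat -> R).

Definition stepB (w : R[i]) (i : nat) (s : R[i] * R[i]) :=
  let k := w / v%:C in
  (shellU k 1 (r i.+1)%:C (r i)%:C s.1 s.2, shellF k 1 (r i.+1)%:C (r i)%:C s.1 s.2).

Definition stepR (w : R[i]) (d : R) (a : R) (i : nat) (s : R[i] * R[i]) :=
  let k := w / vr%:C in
  (shellU k d%:C a%:C (r i)%:C s.1 s.2, shellF k d%:C a%:C (r i)%:C s.1 s.2).

(* [a] is [r 4] for [N = 4], and [0] for [N = 3]. *)
Definition outgoing (w : R[i]) (d a : R) (s : R[i] * R[i]) : R[i] :=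
  let s1 := stepR w d (r 2) 1 (stepB w 2 (stepR w d a 3 s)) in
  s1.1 + (r 1)%:C * s1.2 - 'i * (w / v%:C) * (r 1)%:C * s1.1.

(** An exterior wave [b h(k|x|)] satisfies [u + |x| u' = i k |x| u]. Solving [b h(k r1) = U] gives
    [b = i k r1 U e^(-i k r1)], and the condition rewrites this as the stated coefficient. *)
Lemma outgoing_value k (r1 U F : R[i]) : k != 0 -> r1 != 0 ->
  U + r1 * F - 'i * k * r1 * U = 0 ->
  let b := (U + r1 * F) / cexp ('i * (k * r1)) in
  sbh (k * r1) * b = U /\ sbh' (k * r1) * b = F / k.
Proof.
move=> k0 r0 /eqP; rewrite subr_eq0 => /eqP h b; rewrite /b /sbh /sbh'.
have e0 := cexp_neq0 ('i * (k * r1)); have i2 := @sqri R.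
split.
  have -> : - 'i * cexp ('i * (k * r1)) / (k * r1) * ((U + r1 * F) / cexp ('i * (k * r1)))
    = - 'i * (U + r1 * F) / (k * r1) by field; rewrite k0 r0 e0.
  by rewrite h; field: i2; rewrite k0 r0.
set E := cexp _ in e0 *.
have -> : (E / (k * r1) + 'i * E / (k * r1) ^+ 2) * ((U + r1 * F) / E) =
  (U + r1 * F) / (k * r1) + 'i * (U + r1 * F) / (k * r1) ^+ 2 by field; rewrite k0 r0 e0.
by rewrite {2}h; field: i2; rewrite k0 r0.
Qed.

Lemma det_Amat4_eq0 (w : R[i]) (d : R) : w != 0 -> 0 < d ->
  0 < r 1 -> 0 < r 2 -> 0 < r 3 -> 0 < r 4 ->
  let k := w / v%:C in
  outgoing w d (r 4) (sbj (k * (r 4)%:C), k * sbj' (k * (r 4)%:C)) = 0 ->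
  \det (Amat 4 vr v r w d) = 0.
Proof.
move=> w0 d0 r1 r2 r3 r4 k.
pose kr := w / vr%:C.
have vC := realC_neq0 v v0; have vrC := realC_neq0 vr vr0; have dC := realC_neq0 d d0.
have k0 : k != 0 by rewrite mulf_neq0 ?invr_eq0.
have kr0 : kr != 0 by rewrite mulf_neq0 ?invr_eq0.
rewrite /outgoing; set s4 := (_, k * _).
set s3 := stepR w d _ 3 s4; set s2 := stepB w 2 s3; set s1 := stepR w d _ 1 s2 => out.
have [q1 q1'] := outgoing_value k _ _ _ k0 (realC_neq0 _ r1) out.
have [i1 i1'] := layer_outer kr d%:C kr0 (r 2)%:C (r 1)%:C s2.1 s2.2 (realC_neq0 _ r1) dC.
have [q2 q2'] := layer_inner kr d%:C kr0 (r 2)%:C s2.1 s2.2 (realC_neq0 _ r2).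
have [i2 i2'] := layer_outer k 1 k0 (r 3)%:C (r 2)%:C s3.1 s3.2 (realC_neq0 _ r2) (oner_neq0 _).
have [q3 q3'] := layer_inner k 1 k0 (r 3)%:C s3.1 s3.2 (realC_neq0 _ r3).
have [i3 i3'] := layer_outer kr d%:C kr0 (r 4)%:C (r 3)%:C s4.1 s4.2 (realC_neq0 _ r3) dC.
have [q4 q4'] := layer_inner kr d%:C kr0 (r 4)%:C s4.1 s4.2 (realC_neq0 _ r4).
rewrite -/s1 -/s2 -/s3 in q1 q1' i1 i1' q2 q2' i2 i2' q3 q3' i3 i3' q4 q4'.
set H0 := _ / cexp _ in q1 q1'.
set J1 := layerJ _ _ _ _ _ in i1 i1' q2 q2'; set H1 := layerH _ _ _ _ _ in i1 i1' q2 q2'.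
set J2 := layerJ _ _ _ _ _ in i2 i2' q3 q3'; set H2 := layerH _ _ _ _ _ in i2 i2' q3 q3'.
set J3 := layerJ _ _ _ _ _ in i3 i3' q4 q4'; set H3 := layerH _ _ _ _ _ in i3 i3' q4 q4'.
(* Block i of the unknowns holds the h-coefficient of layer i-1 and the j-coefficient of layer i.
   The core wave is normalised to coefficient 1, which makes the vector nonzero. *)
pose x j := nth (0 : R[i]) [:: H0; J1; H1; J2; H2; J3; H3; 1] j.
(* Flux rows compare d/dt on the two sides: tau converts from [kr] to [k], and the common flux [F]
   produces the factor delta. *)
have tau (y z F : R[i]) : y = d%:C * F / kr -> z = F / k -> (v / vr)%:C * y = d%:C * z.
  by move=> -> ->; rewrite fmorph_div /kr /k /=; field; rewrite w0 vC vrC.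
apply: (@det_eq0_kernel _ _ x (@Ordinal 8 7 isT)); first exact: oner_neq0.
move=> i; under eq_bigr do rewrite mxE.
rewrite (sum_nat8 (fun j => Ablock vr v r w d (i./2).+1 (j./2).+1 (odd i) (odd j) * x j)).
have q5 : sbj (k * (r 4)%:C) * 1 = s4.1 by rewrite mulr1.
have q5' : sbj' (k * (r 4)%:C) * 1 = s4.2 / k by rewrite /s4 /= mulr1; field.
rewrite mul1r in i2'; rewrite mul1r in q3'.
case: i => -[|[|[|[|[|[|[|[|n]]]]]]]] hi; rewrite /Ablock /ent2 /x /= -/k -/kr //.
- by apply: (eq0_of_eq _ _ _ (etrans i1 (esym q1))); ring.
- by apply: (eq0_of_eq _ _ _ (tau _ _ _ i1' q1')); ring.
- by apply: (eq0_of_eq _ _ _ (etrans i2 (esym q2))); ring.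
- by apply: (eq0_of_eq _ _ _ (esym (tau _ _ _ q2' i2'))); ring.
- by apply: (eq0_of_eq _ _ _ (etrans i3 (esym q3))); ring.
- by apply: (eq0_of_eq _ _ _ (tau _ _ _ i3' q3')); ring.
- by apply: (eq0_of_eq _ _ _ (etrans q5 (esym q4))); ring.
- by apply: (eq0_of_eq _ _ _ (esym (tau _ _ _ q4' q5'))); ring.
Qed.

Lemma det_Amat3_eq0 (w : R[i]) (d : R) : w != 0 -> 0 < d ->
  0 < r 1 -> 0 < r 2 -> 0 < r 3 ->
  outgoing w d 0 (1, 0) = 0 -> \det (Amat 3 vr v r w d) = 0.
Proof.
move=> w0 d0 r1 r2 r3.
pose k := w / v%:C; pose kr := w / vr%:C.
have vC := realC_neq0 v v0; have vrC := realC_neq0 vr vr0; have dC := realC_neq0 d d0.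
have k0 : k != 0 by rewrite mulf_neq0 ?invr_eq0.
have kr0 : kr != 0 by rewrite mulf_neq0 ?invr_eq0.
rewrite /outgoing; set s4 := (_, _ : R[i]).
set s3 := stepR w d _ 3 s4; set s2 := stepB w 2 s3; set s1 := stepR w d _ 1 s2 => out.
have [q1 q1'] := outgoing_value k _ _ _ k0 (realC_neq0 _ r1) out.
have [i1 i1'] := layer_outer kr d%:C kr0 (r 2)%:C (r 1)%:C s2.1 s2.2 (realC_neq0 _ r1) dC.
have [q2 q2'] := layer_inner kr d%:C kr0 (r 2)%:C s2.1 s2.2 (realC_neq0 _ r2).
have [i2 i2'] := layer_outer k 1 k0 (r 3)%:C (r 2)%:C s3.1 s3.2 (realC_neq0 _ r2) (oner_neq0 _).
have [q3 q3'] := layer_inner k 1 k0 (r 3)%:C s3.1 s3.2 (realC_neq0 _ r3).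
have [i3 i3'] := layer_outer kr d%:C kr0 0%:C (r 3)%:C s4.1 s4.2 (realC_neq0 _ r3) dC.
rewrite -/s1 -/s2 -/s3 in q1 q1' i1 i1' q2 q2' i2 i2' q3 q3' i3 i3'.
have tr0 : ccos 0 = 1 :> R[i] /\ csin 0 = 0 :> R[i].
  by rewrite /ccos /csin mulr0 oppr0 cexp0 subrr mul0r; split=> //; field.
(* Inner radius 0 with state (1, 0) selects the regular wave: coefficient 1 on j and 0 on h. *)
have [J30 H30] : layerJ kr d%:C 0%:C s4.1 s4.2 = 1 /\ layerH kr d%:C 0%:C s4.1 s4.2 = 0.
  rewrite /layerJ /layerH /layer_sin /layer_cos rmorph0 !mulr0 !mul0r.
  by case: tr0 => -> ->; rewrite /s4 /=; split; ring.
rewrite J30 H30 !mulr0 !add0r in i3 i3'.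
set H0 := _ / cexp _ in q1 q1'.
set J1 := layerJ _ _ _ _ _ in i1 i1' q2 q2'; set H1 := layerH _ _ _ _ _ in i1 i1' q2 q2'.
set J2 := layerJ _ _ _ _ _ in i2 i2' q3 q3'; set H2 := layerH _ _ _ _ _ in i2 i2' q3 q3'.
pose x j := nth (0 : R[i]) [:: H0; J1; H1; J2; H2; 1] j.
have tau (y z F : R[i]) : y = d%:C * F / kr -> z = F / k -> (v / vr)%:C * y = d%:C * z.
  by move=> -> ->; rewrite fmorph_div /kr /k /=; field; rewrite w0 vC vrC.
apply: (@det_eq0_kernel _ _ x (@Ordinal 6 5 isT)); first exact: oner_neq0.
move=> i; under eq_bigr do rewrite mxE.
rewrite (sum_nat6 (fun j => Ablock vr v r w d (i./2).+1 (j./2).+1 (odd i) (odd j) * x j)).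
rewrite mul1r in i2'; rewrite mul1r in q3'.
case: i => -[|[|[|[|[|[|n]]]]]] hi; rewrite /Ablock /ent2 /x /= -/k -/kr //.
- by apply: (eq0_of_eq _ _ _ (etrans i1 (esym q1))); ring.
- by apply: (eq0_of_eq _ _ _ (tau _ _ _ i1' q1')); ring.
- by apply: (eq0_of_eq _ _ _ (etrans i2 (esym q2))); ring.
- by apply: (eq0_of_eq _ _ _ (esym (tau _ _ _ q2' i2'))); ring.
- by apply: (eq0_of_eq _ _ _ (etrans i3 (esym q3))); ring.
- by apply: (eq0_of_eq _ _ _ (tau _ _ _ i3' q3')); ring.
Qed.

End Determinant.

(** Vieta: [M] and [M'] are the roots of [b x^2 - A x + 1] in x = z^2. *)
Lemma quartic_factor (R : realType) (b c M M' A : R) (z : R[i]) :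
  c ^+ 2 = M -> b * (M + M') = A -> b * (M * M') = 1 ->
  (z - c%:C) * (b%:C * (z + c%:C) * (z ^+ 2 - M'%:C)) = 1 - z ^+ 2 * A%:C + z ^+ 4 * b%:C.
Proof. by move=> <- <- hb; rewrite -(rmorph1 (real_complex R)) -hb; ring. Qed.

(** * A resonance attached to one root of the leading quadratic *)

Section Root.
Context {R : realType}.
Variables (vr v : R) (vr0 : 0 < vr) (v0 : 0 < v).
Variables (r : nat -> R) (a : R).
Hypotheses (a0 : 0 <= a) (ar3 : a < r 3) (r32 : r 3 < r 2) (r21 : r 2 < r 1).
Variables (u f : R[i] -> R[i]).
Hypothesis uA : forall c : R, 0 < c ->
  agree2 c (fun z e => u (e%:C * z)) (fun _ _ => 1).
Hypothesis fA : forall c : R, 0 < c ->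
  agree2 c (fun z e => f (e%:C * z)) (fun _ _ => 0).

Let r3 : 0 < r 3. Proof. exact: le_lt_trans ar3. Qed.
Let r2 : 0 < r 2. Proof. exact: lt_trans r3 r32. Qed.
Let r1 : 0 < r 1. Proof. exact: lt_trans r2 r21. Qed.
Let q : R := r 3 ^+ 3 - a ^+ 3.
Let Q : R := r 1 ^+ 3 - r 2 ^+ 3.
Let P : R := Q * q * (r 2 - r 3).
Let Xi : R := r 2 * r 3 * (Q + q) + r 1 * (r 2 - r 3) * q.

Let q0 : 0 < q.
Proof. by rewrite subr_gt0 ltrXn2r // ?nnegrE // ltW. Qed.
Let Q0 : 0 < Q.
Proof. by rewrite subr_gt0 ltrXn2r // ?nnegrE // ltW. Qed.
Let P0 : 0 < P.
Proof. by rewrite !mulr_gt0 // subr_gt0. Qed.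

Let s z (e : R) : R[i] * R[i] := (u (e%:C * z), f (e%:C * z)).
Let s1 z (e : R) := stepR vr r (e%:C * z) (e ^+ 2) (r 2) 1
  (stepB v r (e%:C * z) 2 (stepR vr r (e%:C * z) (e ^+ 2) a 3 (s z e))).

(** Coefficients of the leading state at [r 1]. With z^2 = 3 vr^2 x, the polynomial
    [1 - alpha z^2 + beta z^4] is, up to the factor [r 1 * r 2 * r 3], the quadratic
    [P x^2 - Xi x + r 1 * r 2 * r 3]. *)
Let gamma : R := q * (r 2 - r 3) / (3 * vr ^+ 2 * r 2 * r 3).
Let alpha : R := Xi / (3 * vr ^+ 2 * (r 1 * r 2 * r 3)).
Let beta : R := P / (9 * vr ^+ 4 * (r 1 * r 2 * r 3)).

Lemma outer_state_agree2 (c : R) : 0 < c ->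
  agree2 c (fun z e => (s1 z e).1) (fun z _ => 1 - z ^+ 2 * gamma%:C) /\
  agree2 c (fun z e => (s1 z e).1 + (r 1)%:C * (s1 z e).2)
    (fun z _ => 1 - z ^+ 2 * alpha%:C + z ^+ 4 * beta%:C).
Proof.
move=> c0; have U4 := uA c c0; have F4 := fA c c0.
have U3 := shellU_resonator c c0 vr vr0 _ _ _ _ U4 F4 a _ r3.
have F3 := shellF_resonator c c0 vr vr0 _ _ _ _ U4 F4 a _ r3.
have U2 := shellU_background c c0 v v0 _ _ _ _ U3 F3 (r 3) _ r2.
have F2 := shellF_background c c0 v v0 _ _ _ _ U3 F3 (r 3) _ r2.
have U1 := shellU_resonator c c0 vr vr0 _ _ _ _ U2 F2 (r 2) _ r1.
have F1 := shellF_resonator c c0 vr vr0 _ _ _ _ U2 F2 (r 2) _ r1.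
have vC := realC_neq0 vr vr0; have r1C := realC_neq0 _ r1.
have r2C := realC_neq0 _ r2; have r3C := realC_neq0 _ r3.
split.
  apply: (agree2_ext _ _ _ _ _ (fun _ _ _ _ => erefl) _ U1) => z e _ _.
  rewrite /gamma /q.
  by field; rewrite vC r2C r3C.
have h := agree2D _ _ _ _ _ U1 (agree2M _ _ _ _ _ (agree2_cst c (r 1)%:C) F1).
apply: (agree2_ext _ _ _ _ _ (fun _ _ _ _ => erefl) _ h) => z e _ _.
rewrite /alpha /beta /Xi /P /Q /q.
by field; rewrite vC r1C r2C r3C.
Qed.

Variables (m m' : R).
Hypotheses (m_gt0 : 0 < m) (mm' : m != m') (sum_m : P * (m + m') = Xi)
  (prod_m : P * (m * m') = r 1 * r 2 * r 3).

(** The leading frequency has square 3 vr^2 m. The damping [c2] is [- (X / Y)], where L(c) = -i X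
    and G(c) = Y in the proof below. *)
Let c : R := vr * Num.sqrt (3 * m).
Let c2 : R := 3 * r 1 ^+ 2 * vr ^+ 2 * (m * (q * (r 2 - r 3)) - r 2 * r 3)
  / (2 * v * P * (m - m')).

Lemma outgoing_root : exists d0 : R, 0 < d0 /\ exists w : R -> R[i],
  [/\ forall d : R, 0 < d < d0 -> w d != 0 /\
        outgoing vr v r (w d) d a (u (w d), f (w d)) = 0,
      forall d : R, 0 < d < d0 -> 0 < complex.Re (w d),
      forall d : R, 0 < d < d0 -> ccont d w &
      exists K : R, forall d : R, 0 < d < d0 ->
        `| w d - ((c * Num.sqrt d)%:C - 'i * (c2 * d)%:C) |
          <= (K * (d * Num.sqrt d))%:C ].
Proof.
have c_gt0 : 0 < c by rewrite mulr_gt0 // sqrtr_gt0 mulr_gt0.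
have c_sqr : c ^+ 2 = 3 * vr ^+ 2 * m.
  by rewrite exprMn sqr_sqrtr; [ring | rewrite mulr_ge0 // ltW].
have r123 : 0 < r 1 * r 2 * r 3 by rewrite !mulr_gt0.
pose G z := beta%:C * (z + c%:C) * (z ^+ 2 - (3 * vr ^+ 2 * m')%:C).
pose L z := - 'i * (r 1 / v)%:C * z * (1 - z ^+ 2 * gamma%:C).
have [HU HF] := outer_state_agree2 c c_gt0.
have zo := has_order_id c (ltW c_gt0).
have cst := has_order_cst c.
have z2o : has_order c 0 (fun z _ => z ^+ 2) by exact: (has_orderM c 0 0 _ _ zo zo).
have Go : has_order c 0 (fun z _ => G z).
  apply: (has_orderM c 0 0); last exact: has_orderD z2o (cst _).
  apply: (has_orderM c 0 0); first exact: cst.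
  exact: has_orderD zo (cst _).
have Lo : has_order c 0 (fun z _ => L z).
  apply: (has_orderM c 0 0); first exact: (has_orderM c 0 0 _ _ (cst _) zo).
  exact: has_orderD (cst _) (has_orderN _ _ _ (has_orderM c 0 0 _ _ z2o (cst _))).
(* Replacing the outer state by its limit makes an error of order 2 in [U + r_1 F]; the error in [U]
   is multiplied by a further e in the radiation term. *)
pose S z e := ((s1 z e).1 + (r 1)%:C * (s1 z e).2 - (1 - z ^+ 2 * alpha%:C + z ^+ 4 * beta%:C))
  + e%:C * ((- 'i * (r 1 / v)%:C) * z * ((s1 z e).1 - (1 - z ^+ 2 * gamma%:C))).
have So : has_order c 2 S.
  have [_ _ hU] := HU; have [_ _ hF] := HF.
  apply: has_orderD hF _.
  have h := has_orderM c _ 2 _ _ (has_orderM c 0 0 _ _ (cst (- 'i * (r 1 / v)%:C)) zo) hU.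
  exact: (has_order_le c 2 3 _ isT (has_orderM c 1 2 _ _ (has_order_eps c) h)).
have beta_gt0 : 0 < beta by rewrite divr_gt0 // !mulr_gt0 // exprn_gt0.
have beta_sum : beta * (3 * vr ^+ 2 * m + 3 * vr ^+ 2 * m') = alpha.
  by rewrite /alpha -sum_m /beta; field; rewrite !gt_eqF.
have beta_prod : beta * (3 * vr ^+ 2 * m * (3 * vr ^+ 2 * m')) = 1.
  have -> : beta * (3 * vr ^+ 2 * m * (3 * vr ^+ 2 * m')) = P * (m * m') / (r 1 * r 2 * r 3).
    by rewrite /beta; field; rewrite !gt_eqF.
  by rewrite prod_m divff // gt_eqF.
pose X : R := r 1 / v * c * (1 - c ^+ 2 * gamma).
pose Y : R := beta * (2 * c) * (c ^+ 2 - 3 * vr ^+ 2 * m').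
have GcE : G c%:C = Y%:C.
  by rewrite /G /Y !(rmorphM, rmorphB, rmorphXn) /= rmorph_nat; ring.
have LcE : L c%:C = - 'i * X%:C.
  by rewrite /L /X !(rmorphM, rmorphB, rmorphXn) /= rmorph1; ring.
have Y_neq0 : Y != 0.
  rewrite /Y c_sqr -mulrBr; apply: mulf_neq0; first by rewrite gt_eqF // mulr_gt0 // mulr_gt0.
  by apply: mulf_neq0; rewrite ?subr_eq0 // gt_eqF // mulr_gt0 // exprn_gt0.
have c2E : c2 = - (X / Y).
  rewrite /c2 /X /Y c_sqr -mulrBr /beta /gamma.
  field; rewrite subr_eq0 mm' !gt_eqF //.
have [|e1 [K [zeta [e10 e11 ball root cont]]]] := perturbed_root c G L S c_gt0 Go Lo So.
  by rewrite GcE fmorph_eq0.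
(* Here e is the square root of d, and the root is [e * zeta e]: the factor e turns the bound K e^2
   into K d^(3/2). *)
exists (e1 ^+ 2); split; first exact: exprn_gt0.
have sq d : 0 < d < e1 ^+ 2 -> [/\ 0 < Num.sqrt d < e1, 0 < Num.sqrt d & d = Num.sqrt d ^+ 2].
  move=> /andP[d0 d1]; rewrite sqrtr_gt0 d0 /=; split=> //; last by rewrite sqr_sqrtr // ltW.
  by rewrite -(ltr_pXn2r (n := 2)) ?nnegrE ?sqrtr_ge0 ?ltW // sqr_sqrtr // ltW.
have re_pos z : halfball c z -> 0 < complex.Re z.
  move=> hz; have := ler_Re_nr (z - c%:C).
  rewrite Re_add Re_opp /= => h; have := le_trans h hz.
  by rewrite ler_norml => /andP[h1 _]; have := c_gt0; lra.
exists (fun d => (Num.sqrt d)%:C * zeta (Num.sqrt d)); split.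
- move=> d /sq [he e0 dE]; have [h _] := root _ he; move: he e0 dE h.
  move: (Num.sqrt d) => e he e0 -> h.
  have hz := ball _ he; have z0 := halfball_neq0 c _ c_gt0 hz.
  split; first by rewrite mulf_neq0 // realC_neq0.
  move: (zeta e) h {hz z0} => z h; rewrite -[RHS]h.
  have -> : outgoing vr v r (e%:C * z) (e ^+ 2) a (u (e%:C * z), f (e%:C * z)) =
    (s1 z e).1 + (r 1)%:C * (s1 z e).2 - 'i * (e%:C * z / v%:C) * (r 1)%:C * (s1 z e).1 by [].
  have vC := realC_neq0 v v0.
  have -> : (z - c%:C) * G z = 1 - z ^+ 2 * alpha%:C + z ^+ 4 * beta%:C.
    exact: quartic_factor c_sqr beta_sum beta_prod.
  rewrite /S /L; move: (s1 z e).1 (s1 z e).2 => U1 F1.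
  by rewrite (fmorph_div _ (r 1) v) /=; field.
- move=> d /sq [he e0 _]; rewrite Re_mul /= mul0r subr0 mulr_gt0 //.
  exact/re_pos/ball.
- move=> d hd; have [he e0 dE] := sq d hd.
  have sc : {for d, continuous (@Num.sqrt R)} by exact: sqrt_continuous.
  have [z1 z2] := cont _ he.
  apply: ccontM; split => /=.
  + exact: sc.
  + exact: cvg_cst.
  + exact: (continuous_comp sc z1).
  + exact: (continuous_comp sc z2).
exists K => d /sq [he e0 dE]; have [_ h] := root _ he.
rewrite nrE lecR; move: h dE e0 {he}; move: (zeta (Num.sqrt d)) => z.
move: (Num.sqrt d) => e h -> e0.
have -> : e%:C * z - ((c * e)%:C - 'i * (c2 * e ^+ 2)%:C) =
    e%:C * (z - (c%:C - e%:C * (L c%:C / G c%:C))).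
  rewrite c2E GcE LcE; move: (c) (X) (Y) Y_neq0 => c' X' Y' Y'_neq0.
  by field; rewrite fmorph_eq0.
rewrite nrM nrR gtr0_norm //.
apply: le_trans (ler_wpM2l (ltW e0) h) _.
by rewrite le_eqVlt; apply/orP; left; apply/eqP; ring.
Qed.

End Root.

Lemma agree2_sbj (R : realType) (c v b : R) : 0 < c -> 0 < v -> 0 < b ->
  agree2 c (fun z e => sbj (e%:C * z / v%:C * b%:C)) (fun _ _ => 1).
Proof.
move=> c0 v0 b0; have bC := realC_neq0 b b0; have vC := realC_neq0 v v0.
have h := agree2M _ _ _ _ _ (agree2_csin c c0 v v0 b%:C) (agree2_cst c (b%:C)^-1).
apply: (agree2_ext _ _ _ _ _ _ _ h) => z e hz e0; last by rewrite mulfV.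
have k0 := wavenumber_neq0 c c0 v v0 z e hz e0.
rewrite /sbj; move: (csin _) => si.
by move: (e%:C * z / v%:C) k0 => k k0; field; rewrite k0 bC.
Qed.

(** Dividing out k gives [ccos (k b) / b - (csin (k b) / k) / b^2], whose two limits 1/b cancel. *)
Lemma agree2_k_sbj' (R : realType) (c v b : R) : 0 < c -> 0 < v -> 0 < b ->
  agree2 c (fun z e => e%:C * z / v%:C * sbj' (e%:C * z / v%:C * b%:C)) (fun _ _ => 0).
Proof.
move=> c0 v0 b0; have bC := realC_neq0 b b0; have vC := realC_neq0 v v0.
have h := agree2B _ _ _ _ _
  (agree2M _ _ _ _ _ (agree2_ccos c c0 v b%:C) (agree2_cst c (b%:C)^-1))
  (agree2M _ _ _ _ _ (agree2_csin c c0 v v0 b%:C) (agree2_cst c (b%:C ^+ 2)^-1)).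
apply: (agree2_ext _ _ _ _ _ _ _ h) => z e hz e0; last by field.
have k0 := wavenumber_neq0 c c0 v v0 z e hz e0.
rewrite /sbj'; move: (csin _) (ccos _) => si co.
by move: (e%:C * z / v%:C) k0 => k k0; field; rewrite k0 bC.
Qed.

Lemma resonance_rootW (R : realType) N (vr v : R) r c1 c2 d0 d1 w : d1 <= d0 ->
  resonance_root N vr v r c1 c2 d0 w -> resonance_root N vr v r c1 c2 d1 w.
Proof.
move=> d10; have sub d : 0 < d < d1 -> 0 < d < d0.
  by move=> /andP[-> h] /=; exact: lt_le_trans d10.
move=> [h1 h2 h3 [K h4]]; split.
- by move=> d /sub; exact: h1.
- by move=> d /sub; exact: h2.
- by move=> d /sub; exact: h3.
by exists K => d /sub; exact: h4.
Qed.

Lemma resonance_root_pair (R : realType) N (vr v : R) r c1 c2 c1' c2' :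
  (exists d0, 0 < d0 /\ exists w, resonance_root N vr v r c1 c2 d0 w) ->
  (exists d0, 0 < d0 /\ exists w, resonance_root N vr v r c1' c2' d0 w) ->
  exists d0 : R, 0 < d0 /\ exists w1 w2 : R -> R[i],
    resonance_root N vr v r c1 c2 d0 w1 /\ resonance_root N vr v r c1' c2' d0 w2.
Proof.
move=> [d [d0 [w hw]]] [d' [d0' [w' hw']]]; exists (Num.min d d').
split; first by rewrite lt_min d0.
by exists w, w'; split; apply: resonance_rootW; [| exact: hw| |exact: hw']; rewrite ge_min lexx ?orbT.
Qed.

(** Applied with [X = r 1 * (r 2 - r 3) * shellq] and [W = r 2 * r 3 * shellQ], whose product is
    [r 1 * r 2 * r 3 * quadP]; the third summand [Y] of [quadXi] makes the discriminant strictly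
    positive. *)
Lemma discriminant_gt0 (R : realType) (X Y W : R) : 0 < X -> 0 < Y -> 0 < W ->
  0 < (X + Y + W) ^+ 2 - 4 * (X * W).
Proof.
move=> X0 Y0 W0.
have -> : (X + Y + W) ^+ 2 - 4 * (X * W) = (X - W) ^+ 2 + (Y ^+ 2 + 2 * Y * (X + W)) by ring.
by rewrite ltr_wpDl ?sqr_ge0 // addr_gt0 ?exprn_gt0 // mulr_gt0 // ?addr_gt0 // mulr_gt0.
Qed.

(** The sign [s] treats both roots at once. Positivity holds because the discriminant is smaller
    than [Xi ^+ 2]. *)
Lemma quadratic_roots (R : realType) (P Xi T s : R) : 0 < P -> 0 < Xi -> 0 < T ->
  0 < Xi ^+ 2 - 4 * (T * P) -> s ^+ 2 = 1 ->
  let D := Num.sqrt (Xi ^+ 2 - 4 * (T * P)) in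
  let m := (Xi + s * D) / (2 * P) in let m' := (Xi - s * D) / (2 * P) in
  [/\ 0 < m, m - m' = s * D / P, P * (m + m') = Xi & P * (m * m') = T].
Proof.
move=> P0 Xi0 T0 De0 s1 D m m'.
have D0 : 0 < D by rewrite sqrtr_gt0.
have D2 : D ^+ 2 = Xi ^+ 2 - 4 * (T * P) by rewrite sqr_sqrtr // ltW.
have sDXi : - Xi < s * D.
  have : (s * D) ^+ 2 < Xi ^+ 2 by rewrite exprMn s1 mul1r D2; nra.
  by nra.
split.
- by rewrite divr_gt0 ?mulr_gt0 //; lra.
- by rewrite /m /m'; field; rewrite gt_eqF.
- by rewrite /m /m'; field; rewrite gt_eqF.
have -> : P * (m * m') = (Xi ^+ 2 - s ^+ 2 * D ^+ 2) / (4 * P).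
  by rewrite /m /m'; field; rewrite gt_eqF.
by rewrite s1 D2; field; rewrite gt_eqF.
Qed.

(** * The two branches, with the core radius as a parameter *)

Section Branches.
Context {R : realType}.
Variables (vr v : R) (vr0 : 0 < vr) (v0 : 0 < v).
Variables (r : nat -> R) (a : R).
Hypotheses (a0 : 0 <= a) (ar3 : a < r 3) (r32 : r 3 < r 2) (r21 : r 2 < r 1).

Definition shellq : R := r 3 ^+ 3 - a ^+ 3.
Definition shellQ : R := r 1 ^+ 3 - r 2 ^+ 3.
Definition quadP : R := shellQ * shellq * (r 2 - r 3).
Definition quadXi : R :=
  r 2 * r 3 * (shellQ + shellq) + r 1 * (r 2 - r 3) * shellq.
Definition quadDelta : R := quadXi ^+ 2 - 4 * (r 1 * r 2 * r 3 * quadP).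

Lemma radii_gt0 : [/\ 0 < r 1, 0 < r 2 & 0 < r 3].
Proof.
have r3 : 0 < r 3 by exact: le_lt_trans ar3.
have r2 : 0 < r 2 by exact: lt_trans r3 r32.
by split=> //; exact: lt_trans r2 r21.
Qed.

Lemma shellq_gt0 : 0 < shellq.
Proof. by rewrite subr_gt0 ltrXn2r // ?nnegrE //; have [] := radii_gt0 => *; lra. Qed.

Lemma shellQ_gt0 : 0 < shellQ.
Proof. by rewrite subr_gt0 ltrXn2r // ?nnegrE //; have [] := radii_gt0 => *; lra. Qed.

Lemma quadP_gt0 : 0 < quadP.
Proof. by rewrite !mulr_gt0 ?shellQ_gt0 ?shellq_gt0 // subr_gt0. Qed.

Lemma quadXi_gt0 : 0 < quadXi.
Proof.
have [r1 r2 r3] := radii_gt0; have q0 := shellq_gt0; have Q0 := shellQ_gt0.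
have d0 : 0 < r 2 - r 3 by rewrite subr_gt0.
by apply: addr_gt0; [rewrite !mulr_gt0 // addr_gt0 | rewrite !mulr_gt0].
Qed.

Lemma quadDelta_gt0 : 0 < quadDelta.
Proof.
have [r1 r2 r3] := radii_gt0; have q0 := shellq_gt0; have Q0 := shellQ_gt0.
have d0 : 0 < r 2 - r 3 by rewrite subr_gt0.
have := discriminant_gt0 R (r 1 * (r 2 - r 3) * shellq) (r 2 * r 3 * shellq) (r 2 * r 3 * shellQ).
rewrite !mulr_gt0 // => /(_ isT isT isT); congr (_ < _).
by rewrite /quadDelta /quadXi /quadP; ring.
Qed.

Variables (u f : R[i] -> R[i]).
Hypothesis uA : forall c : R, 0 < c ->
  agree2 c (fun z e => u (e%:C * z)) (fun _ _ => 1).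
Hypothesis fA : forall c : R, 0 < c ->
  agree2 c (fun z e => f (e%:C * z)) (fun _ _ => 0).

(** The number of layers enters only through the hypothesis on the determinant. The form of [c2]
    follows from [m - m' = s * D / quadP], with [D] the root of the discriminant, after cancelling
    [quadP]. *)
Lemma resonance_branch (N : nat) (s c1 c2 : R) : s ^+ 2 = 1 ->
  (forall (w : R[i]) (d : R), w != 0 -> 0 < d ->
    outgoing vr v r w d a (u w, f w) = 0 -> \det (Amat N vr v r w d) = 0) ->
  c1 = vr * Num.sqrt (3 * ((quadXi + s * Num.sqrt quadDelta) / (2 * quadP))) ->
  c2 = 3 * (quadXi + s * Num.sqrt quadDelta - 2 * (r 2 * r 3 * shellQ))
    / (4 * (v / vr) * shellQ * (s * Num.sqrt quadDelta)) * vr * r 1 ^+ 2 ->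
  exists d0, 0 < d0 /\ exists w, resonance_root N vr v r c1 c2 d0 w.
Proof.
move=> s1 detN c1E c2E; have [r1 r2 r3] := radii_gt0.
have q0 := shellq_gt0; have Q0 := shellQ_gt0; have P0 := quadP_gt0.
have D0 : 0 < Num.sqrt quadDelta by rewrite sqrtr_gt0 quadDelta_gt0.
have T0 : 0 < r 1 * r 2 * r 3 by rewrite !mulr_gt0.
have s0 : s != 0 by apply: contra_eq_neq s1 => ->; rewrite expr0n eq_sym oner_neq0.
have [m0 mD mS mM] := quadratic_roots R quadP quadXi (r 1 * r 2 * r 3) s P0 quadXi_gt0 T0 quadDelta_gt0 s1.
rewrite -/quadDelta in m0 mD mS mM.
set m := (quadXi + _) / _ in m0 mD mS mM c1E; set m' := (quadXi - _) / _ in mD mS mM.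
have mm' : m != m'.
  by rewrite -subr_eq0 mD !mulf_neq0 ?invr_eq0 // gt_eqF.
have [d0 [d00 [w [root re cont [K bound]]]]] :=
  outgoing_root vr v vr0 v0 r a a0 ar3 r32 r21 u f uA fA m m' m0 mm' mS mM.
exists d0; split=> //; exists w; split.
- by move=> d hd; have [w0 o] := root d hd; apply: detN => //; case/andP: hd.
- exact: re.
- exact: cont.
exists K => d hd; have := bound d hd.
have -> : c1 = vr * Num.sqrt (3 * m) by [].
suff -> : c2 = 3 * r 1 ^+ 2 * vr ^+ 2 * (m * (shellq * (r 2 - r 3)) - r 2 * r 3)
  / (2 * v * quadP * (m - m')) by [].
rewrite mD c2E /m /quadP; field.
by rewrite s0 !gt_eqF // subr_gt0.
Qed.

End Branches.

Theorem mainTheorem4 (R : realType) (vr v : R) (hvr : 0 < vr) (hv : 0 < v) :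
  let tau := v / vr in
  (* (i) N = 3 *)
  (forall r : nat -> R, 0 < r 3%N -> r 3%N < r 2%N -> r 2%N < r 1%N ->
    let Xi := Xi3 r in let De := Delta3 r in
    let Q := r 1%N ^+ 3 - r 2%N ^+ 3 in
    0 < De /\
    exists d0 : R, 0 < d0 /\
    exists w1 w2 : R -> R[i],
      resonance_root 3 vr v r
        (vr * Num.sqrt ((3%:R * Xi - 3%:R * Num.sqrt De)
                        / (2%:R * (r 2%N - r 3%N) * Q * r 3%N ^+ 2)))
        ((3%:R * (- Xi + Num.sqrt De) + 6%:R * r 2%N * Q)
           / (4%:R * tau * Q * Num.sqrt De) * r 1%N ^+ 2 * vr)
        d0 w1 /\
      resonance_root 3 vr v r
        (vr * Num.sqrt ((3%:R * Xi + 3%:R * Num.sqrt De)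
                        / (2%:R * (r 2%N - r 3%N) * Q * r 3%N ^+ 2)))
        ((3%:R * (Xi + Num.sqrt De) - 6%:R * r 2%N * Q)
           / (4%:R * tau * Q * Num.sqrt De) * r 1%N ^+ 2 * vr)
        d0 w2) /\
  (* (ii) N = 4 *)
  (forall r : nat -> R, 0 < r 4%N -> r 4%N < r 3%N -> r 3%N < r 2%N -> r 2%N < r 1%N ->
    let Xi := Xi4 r in let De := Delta4 r in let P := P4 r in
    let Q := r 1%N ^+ 3 - r 2%N ^+ 3 in
    0 < De /\
    exists d0 : R, 0 < d0 /\
    exists w1 w2 : R -> R[i],
      resonance_root 4 vr v r
        (vr * Num.sqrt ((3%:R * Xi - 3%:R * Num.sqrt De) / (2%:R * P)))
        ((3%:R * (- Xi + Num.sqrt De) + 6%:R * r 2%N * r 3%N * Q)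
           / (4%:R * tau * Q * Num.sqrt De) * vr * r 1%N ^+ 2)
        d0 w1 /\
      resonance_root 4 vr v r
        (vr * Num.sqrt ((3%:R * Xi + 3%:R * Num.sqrt De) / (2%:R * P)))
        ((3%:R * (Xi + Num.sqrt De) - 6%:R * r 2%N * r 3%N * Q)
           / (4%:R * tau * Q * Num.sqrt De) * vr * r 1%N ^+ 2)
        d0 w2).
Proof.
have s1 : (-1 : R) ^+ 2 = 1 by rewrite sqrrN expr1n.
have s1' : (1 : R) ^+ 2 = 1 by rewrite expr1n.
move=> tau; split=> r.
  move=> r3 r32 r21 Xi De Q.
  have r2 := lt_trans r3 r32; have r1 := lt_trans r2 r21.
  have a0 : 0 <= (0 : R) by [].
  (* For a core of radius 0 a factor [r 3] splits off from [quadXi], [quadP] and the root of the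
     discriminant; it cancels in both coefficients. *)
  have XiE : quadXi r 0 = r 3 * Xi.
    by rewrite /Xi /Xi3 /quadXi /shellQ /shellq expr0n subr0; ring.
  have PE : quadP r 0 = r 3 * (r 3 ^+ 2 * (r 2 - r 3) * Q).
    by rewrite /Q /quadP /shellQ /shellq expr0n subr0; ring.
  have DeE : quadDelta r 0 = r 3 ^+ 2 * De.
    by rewrite /De /Delta3 /quadDelta XiE PE /Xi /Q; ring.
  have De0 : 0 < De.
    by have := quadDelta_gt0 r 0 a0 r3 r32 r21; rewrite DeE pmulr_rgt0 // exprn_gt0.
  split=> //.
  have D0 : 0 < Num.sqrt De by rewrite sqrtr_gt0.
  have sE : Num.sqrt (quadDelta r 0) = r 3 * Num.sqrt De.
    by rewrite DeE sqrtrM ?sqr_ge0 // sqrtr_sqr gtr0_norm.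
  have Q0 : 0 < Q by exact: shellQ_gt0 r 0 a0 r3 r32 r21.
  have QE : shellQ r = Q by [].
  have d0 : r 2 - r 3 != 0 by rewrite gt_eqF // subr_gt0.
  have detN w d : w != 0 -> 0 < d ->
    outgoing vr v r w d 0 (1, 0) = 0 -> \det (Amat 3 vr v r w d) = 0.
    by move=> w0 d0'; exact: det_Amat3_eq0.
  (* The initial state is exactly (1, 0), so its limits are immediate. *)
  have branch := resonance_branch vr v hvr hv r 0 a0 r3 r32 r21 (fun=> 1) (fun=> 0)
    (fun c _ => agree2_cst c 1) (fun c _ => agree2_cst c 0) 3.
  apply: resonance_root_pair.
    apply: (branch (-1) _ _ s1 detN); rewrite sE XiE ?PE ?QE.
      by congr (_ * Num.sqrt _); field; rewrite d0 !gt_eqF.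
    by rewrite /tau; field; rewrite !gt_eqF.
  apply: (branch 1 _ _ s1' detN); rewrite sE XiE ?PE ?QE.
    by congr (_ * Num.sqrt _); field; rewrite d0 !gt_eqF.
  by rewrite /tau; field; rewrite !gt_eqF.
move=> r4 r43 r32 r21 Xi De P Q.
have r3 := lt_trans r4 r43; have r2 := lt_trans r3 r32; have r1 := lt_trans r2 r21.
have XiE : quadXi r (r 4) = Xi by rewrite /Xi /Xi4 /quadXi /shellQ /shellq; ring.
have PE : quadP r (r 4) = P by [].
have DeE : quadDelta r (r 4) = De by rewrite /De /Delta4 /quadDelta XiE PE /Xi /P; ring.
have De0 : 0 < De by rewrite -DeE quadDelta_gt0 // ltW.
split=> //.
have D0 : 0 < Num.sqrt De by rewrite sqrtr_gt0.
have Q0 : 0 < Q by exact: shellQ_gt0 r (r 4) (ltW r4) r43 r32 r21.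
have P0 : 0 < P by rewrite -PE quadP_gt0 // ltW.
have QE : shellQ r = Q by [].
have detN w d : w != 0 -> 0 < d ->
  outgoing vr v r w d (r 4) (sbj (w / v%:C * (r 4)%:C), w / v%:C * sbj' (w / v%:C * (r 4)%:C)) = 0 ->
  \det (Amat 4 vr v r w d) = 0.
  by move=> w0 d0; exact: det_Amat4_eq0.
have branch := resonance_branch vr v hvr hv r (r 4) (ltW r4) r43 r32 r21
  (fun w => sbj (w / v%:C * (r 4)%:C)) (fun w => w / v%:C * sbj' (w / v%:C * (r 4)%:C))
  (fun c c0 => agree2_sbj R c v (r 4) c0 hv r4)
  (fun c c0 => agree2_k_sbj' R c v (r 4) c0 hv r4) 4.
apply: resonance_root_pair.
  apply: (branch (-1) _ _ s1 detN); rewrite DeE XiE ?PE ?QE.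
    by congr (_ * Num.sqrt _); field; rewrite gt_eqF.
  by rewrite /tau; field; rewrite !gt_eqF.
apply: (branch 1 _ _ s1' detN); rewrite DeE XiE ?PE ?QE.
  by congr (_ * Num.sqrt _); field; rewrite gt_eqF.
by rewrite /tau; field; rewrite !gt_eqF.
Qed.
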